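(* Let $\theta\in\mathbb A_{1,\pi}$ with $\theta'(0)>0$. Put $\theta_n=\theta^{(n)}(0)$, $n\ge 0$, and let $g_1,g_2$ be defined by $$g_1=\frac12\,\frac{1-4\theta_1-\theta_0^2}{1-\theta_0^2},$$ $$g_2=\frac12\,\frac{(16\theta_1^2-8\theta_2-\theta_0+\theta_0^2+\theta_0^3-8\theta_2\theta_0-1)(1-\theta_0)}{(1-\theta_0^2+4\theta_1)(4\theta_1-1+\theta_0^2)}.$$ Let $$D_1=(1-g_1)^2-4g_1^2g_2(1-g_2),\qquad D_2=g_1^2-4(1-g_1)^2(1-g_2)g_2,$$ and define, as functions of $g_1,g_2$, $$t^{(1)}_1=\frac{1-g_1-\sqrt{D_1}}{2g_1(1-g_2)},\quad t^{(1)}_2=\frac{1-g_1+\sqrt{D_1}}{2g_1(1-g_2)},\quad t^{(2)}_1=\frac{g_1-\sqrt{D_2}}{2(1-g_1)g_2},\quad t^{(2)}_2=\frac{g_1+\sqrt{D_2}}{2(1-g_1)g_2}.$$ I. Assume that $(g_1,g_2)\in[0,1]^2$ belongs to one of the two regions $$E=\{(g_1,g_2)\in(0,1)^2 : D_2\ge0,\ 0<g_1<1/2,\ 0<g_2<1/2\},$$ $$F=\{(g_1,g_2)\in(0,1)^2 : D_2\ge0,\ 0<g_1<1/2,\ 1/2<g_2<1\}.$$ Let $$\zeta=2\log(t^{(2)}_1)>0\ \text{ if } (g_1,g_2)\in E,\qquad \zeta=2\log(t^{(2)}_2)<0\ \text{ if } (g_1,g_2)\in F.$$ Then there exists $\tau\in\mathbb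 R$, $\tau\ne0$, such that $\theta(\tau)=\theta(0)$, and $\tau\in(0,\zeta)$ if $\zeta>0$, and $\tau\in(\zeta,0)$ if $\zeta<0$. II. Let $\tau\in\mathbb R$, $\tau\neq0$, be such that $\theta(\tau)=\theta(0)$. Then $$\tau\in\left(-\infty,\,2\log(t^{(1)}_1)\right]\cup\left[2\log(t^{(1)}_2),\,+\infty\right).$$
   Context: $\mathbb A_{1,\pi}$ is the set of functions $\theta$ holomorphic in the strip $S=\{z\in\mathbb C:|\mathrm{Im}(z)|<\pi\}$ with $\theta(\mathbb R)\subset\mathbb R$ and $|\theta(z)|<1$ for all $z\in S$. The numbers $g_1,g_2$ are the first two coefficients in the representation $\theta(z)=1-\dfrac{2}{\mu e^{z/2}g(e^z-1)+1}$, $z\in S$, where $\mu=\frac{1+\theta_0}{1-\theta_0}$ and $g(w)=\cfrac{1}{1+\cfrac{g_1w}{1+\cfrac{(1-g_1)g_2w}{1+\cfrac{(1-g_2)g_3w}{1+\cdots}}}}$ is a continued $g$-fraction with all $g_k\in[0,1]$.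
   Formalization: In Part I, τ=ζ is allowed when the g-fraction of θ terminates with g_3=0, where the open-interval claim fails (e.g. θ_0=0, g_1=13/33, g_2=1/10). In Part II, log 0 is −∞, and at g_2=1, where t^(1) is undefined, the limits g_1/(1−g_1) and +∞ are used. *)

(* Defs.v *)
From Stdlib Require Import Reals.
From Coquelicot Require Import Coquelicot.
Open Scope R_scope.

Definition strip (z : C) : Prop := Rabs (Im z) < PI.

(* Functions are total on C; only their values on the strip matter. *)
Definition A_1_pi (theta : C -> C) : Prop :=
  (forall z : C, strip z -> ex_derive (K := C_AbsRing) theta z) /\
  (forall x : R, Im (theta (RtoC x)) = 0) /\
  (forall z : C, strip z -> Cmod (theta z) < 1).

Fixpoint C_derive_n (f : C -> C) (n : nat) : C -> C :=
  match n with
  | O => f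
  | S m => C_derive (C_derive_n f m)
  end.

(* The n-th complex derivative at 0.  It is a real number when theta is real
   on the real axis, so taking its real part only changes its type. *)
Definition taylor (theta : C -> C) (n : nat) : R :=
  Re (C_derive_n theta n (RtoC 0)).

Definition coef_g1 (theta : C -> C) : R :=
  let th0 := taylor theta 0 in
  let th1 := taylor theta 1 in
  / 2 * ((1 - 4 * th1 - th0 ^ 2) / (1 - th0 ^ 2)).

Definition coef_g2 (theta : C -> C) : R :=
  let th0 := taylor theta 0 in
  let th1 := taylor theta 1 in
  let th2 := taylor theta 2 in
  / 2 * (((16 * th1 ^ 2 - 8 * th2 - th0 + th0 ^ 2 + th0 ^ 3
             - 8 * th2 * th0 - 1) * (1 - th0))
         / ((1 - th0 ^ 2 + 4 * th1) * (4 * th1 - 1 + th0 ^ 2))).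

Definition D1 (g1 g2 : R) : R := (1 - g1) ^ 2 - 4 * g1 ^ 2 * g2 * (1 - g2).
Definition D2 (g1 g2 : R) : R := g1 ^ 2 - 4 * (1 - g1) ^ 2 * (1 - g2) * g2.

(* t1_i and t2_i stand for t^(1)_i and t^(2)_i. *)
Definition t1_1 (g1 g2 : R) : R :=
  (1 - g1 - sqrt (D1 g1 g2)) / (2 * g1 * (1 - g2)).
Definition t1_2 (g1 g2 : R) : R :=
  (1 - g1 + sqrt (D1 g1 g2)) / (2 * g1 * (1 - g2)).
Definition t2_1 (g1 g2 : R) : R :=
  (g1 - sqrt (D2 g1 g2)) / (2 * (1 - g1) * g2).
Definition t2_2 (g1 g2 : R) : R :=
  (g1 + sqrt (D2 g1 g2)) / (2 * (1 - g1) * g2).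

Definition region_E (g1 g2 : R) : Prop :=
  0 <= D2 g1 g2 /\ 0 < g1 < / 2 /\ 0 < g2 < / 2.
Definition region_F (g1 g2 : R) : Prop :=
  0 <= D2 g1 g2 /\ 0 < g1 < / 2 /\ / 2 < g2 < 1.

(* The g-fraction with g_3 = 0, which terminates after its g_2 term. *)
Definition terminating_g_fraction (g1 g2 w : R) : R :=
  1 / (1 + g1 * w / (1 + (1 - g1) * g2 * w)).

(* The representation theta(z) = 1 - 2 / (mu e^(z/2) g(e^z - 1) + 1) holds with
   g_3 = 0.  By the identity theorem it is enough to require it on the real
   line, where the denominators are positive.  Such a theta takes the value
   theta(0) only at 0, 2 log t^(2)_1 and 2 log t^(2)_2 (when D2 >= 0), so for
   it there is no solution strictly between 0 and the bound zeta. *)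
Definition terminating (theta : C -> C) : Prop :=
  let th0 := taylor theta 0 in
  let mu := (1 + th0) / (1 - th0) in
  forall x : R,
    theta (RtoC x) =
    RtoC (1 - 2 / (mu * exp (x / 2) *
                   terminating_g_fraction (coef_g1 theta) (coef_g2 theta)
                     (exp x - 1) + 1)).

(* tau <= 2 log t with log 0 = - infinity: Stdlib's [ln] is 0 at t <= 0. *)
Definition le_2log (tau t : R) : Prop := 0 < t /\ tau <= 2 * ln t.

(* tau lies in (-oo, 2 log t^(1)_1] U [2 log t^(1)_2, +oo).  The formulas for
   t^(1)_i divide by zero at g2 = 1, where their limits as g2 -> 1- are
   g1 / (1 - g1) and +oo (for 0 < g1 < 1/2); hence the second clause. *)
Definition outside_gap (g1 g2 tau : R) : Prop :=
  (g2 <> 1 -> le_2log tau (t1_1 g1 g2) \/ 2 * ln (t1_2 g1 g2) <= tau) /\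
  (g2 = 1 -> le_2log tau (g1 / (1 - g1))).

(* Main.v *)
(** A conformal map carries the strip to the unit disc and [theta] to a real
    function [f] with [|f| <= 1]; there [w = tanh (tau / 4)].  Two steps of the
    Schur algorithm, [F_k(w) - F_k(0) = w F_(k+1)(w) (1 - F_k(0) F_k(w))], give
    [a = F_1(0)] and [b = F_2(0)] with [g1 = (1 - a) / 2], [g2 = (1 + b) / 2].  For
    [tau <> 0], [theta(tau) = theta(0)] means [F_1(w) = 0], that is
    [w F_2(w) = - a], while the Schwarz-Pick inequality confines [F_2(w)] to an
    interval determined by [b] and [w].  Its endpoints give the quadratic
    equations in [u = exp (tau / 2)] whose roots are the [t^(i)_j].  For the first
    part the bound forces [F_1 <= 0] at the root, so the intermediate value
    theorem applies; equality there makes [F_3] identically [1], the terminating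
    case.

    The function theory rests on Goursat's theorem for rectangles: applied to
    [F (exp (s + i t))], which is periodic in [t], it makes integrals over
    concentric circles independent of the radius, and Cauchy's formula,
    removability and the maximum principle follow. *)
Require Import Defs.
From Stdlib Require Import Reals Lra Lia ClassicalEpsilon FunctionalExtensionality.
From Coquelicot Require Import Coquelicot.
Open Scope R_scope.

(** * Complex derivatives *)

(** Differentiability is taken in Carathéodory's form: the difference quotient, completed at the
    base point, is a total function, so the rules of calculus become identities between continuous
    functions. A Schur step is such a quotient, and removability makes it holomorphic again. The
    complex [is_derive] enters only where [theta] and [C_derive] do. No derivative of an [F_k] is
    ever computed: the numbers [a] and [b] are tied to the derivatives of [theta] by comparing
    expansions whose remainders are continuous at 0. The two families of bounds are the two extreme
    values of [F_3]. Since [F_2(w) = (b + w h) / (1 + b w h)] with [h = F_3(w)], the equation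
    [w F_2(w) = - a] reads [w^2 + b (1 + a) w + a = 0] for [h = 1], which leads to the [t^(2)_j],
    and [w^2 - b (1 - a) w - a = 0] for [h = -1], which leads to the [t^(1)_j]. At a root of the
    former, [F_1(w)] is a positive multiple of [h - 1]; this is the sign that the intermediate value
    theorem uses. *)

Definition ccont (f : C -> C) (z : C) : Prop :=
  forall eps, 0 < eps -> exists delta, 0 < delta /\
    forall w, Cmod (w - z) < delta -> Cmod (f w - f z) < eps.

Definition slope (f : C -> C) (z l w : C) : C :=
  if Ceq_dec w z then l else ((f w - f z) / (w - z))%C.

Definition cderiv (f : C -> C) (z l : C) : Prop := ccont (slope f z l) z.

Lemma slope_same f z l : slope f z l z = l.
Proof. unfold slope; destruct (Ceq_dec z z); congruence. Qed.

Lemma Cminus_neq0 (w z : C) : w <> z -> (w - z <> 0)%C.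
Proof. intros H E; apply H. replace w with (w - z + z)%C by ring. rewrite E; ring. Qed.

Lemma slope_mul f z l w : (f w - f z = slope f z l w * (w - z))%C.
Proof.
  unfold slope; destruct (Ceq_dec w z) as [->|H].
  - ring.
  - field; now apply Cminus_neq0.
Qed.

Lemma Cmod_minus_sym x y : Cmod (x - y) = Cmod (y - x).
Proof. rewrite <- Cmod_opp; f_equal; ring. Qed.

Lemma Cmod_minus_le x y : Cmod x <= Cmod y + Cmod (x - y).
Proof. replace x with (y + (x - y))%C at 1 by ring; apply Cmod_triangle. Qed.

Lemma ccont_local f g z r :
  0 < r -> (forall w, Cmod (w - z) < r -> f w = g w) -> ccont f z -> ccont g z.
Proof.
  intros Hr E Hf e He; destruct (Hf e He) as [d [Hd H]].
  exists (Rmin d r); split; [now apply Rmin_glb_lt|].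
  intros w Hw. rewrite <- !E.
  - apply H. eapply Rlt_le_trans; [exact Hw|apply Rmin_l].
  - replace (z - z)%C with (RtoC 0) by ring. now rewrite Cmod_0.
  - eapply Rlt_le_trans; [exact Hw|apply Rmin_r].
Qed.

Lemma ccont_const c z : ccont (fun _ => c) z.
Proof.
  intros e He; exists 1; split; [lra|intros w _].
  replace (c - c)%C with (RtoC 0) by ring. now rewrite Cmod_0.
Qed.

Lemma ccont_id z : ccont (fun w => w) z.
Proof. intros e He; exists e; auto. Qed.

Lemma ccont_plus f g z : ccont f z -> ccont g z -> ccont (fun w => f w + g w)%C z.
Proof.
  intros Hf Hg e He.
  destruct (Hf (e / 2)) as [d1 [Hd1 H1]]; [lra|].
  destruct (Hg (e / 2)) as [d2 [Hd2 H2]]; [lra|].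
  exists (Rmin d1 d2); split; [now apply Rmin_glb_lt|]. intros w Hw.
  specialize (H1 w (Rlt_le_trans _ _ _ Hw (Rmin_l _ _))).
  specialize (H2 w (Rlt_le_trans _ _ _ Hw (Rmin_r _ _))).
  replace (f w + g w - (f z + g z))%C with (f w - f z + (g w - g z))%C by ring.
  pose proof (Cmod_triangle (f w - f z) (g w - g z)). lra.
Qed.

Lemma ccont_mult f g z : ccont f z -> ccont g z -> ccont (fun w => f w * g w)%C z.
Proof.
  intros Hf Hg e He.
  set (A := Cmod (f z) + Cmod (g z) + 1).
  pose proof (Cmod_ge_0 (f z)); pose proof (Cmod_ge_0 (g z)).
  set (h := Rmin 1 (e / (2 * A))).
  assert (HA : 0 < A) by (unfold A; lra).
  assert (Hh : 0 < h) by (apply Rmin_glb_lt; [lra|apply Rdiv_lt_0_compat; lra]).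
  assert (h1 : h <= 1) by apply Rmin_l.
  assert (h2 : h * A <= e / 2).
  { replace (e / 2) with (e / (2 * A) * A) by (field; lra).
    apply Rmult_le_compat_r; [lra|apply Rmin_r]. }
  destruct (Hf h Hh) as [d1 [Hd1 H1]]; destruct (Hg h Hh) as [d2 [Hd2 H2]].
  exists (Rmin d1 d2); split; [now apply Rmin_glb_lt|]. intros w Hw.
  specialize (H1 w (Rlt_le_trans _ _ _ Hw (Rmin_l _ _))).
  specialize (H2 w (Rlt_le_trans _ _ _ Hw (Rmin_r _ _))).
  replace (f w * g w - f z * g z)%C
    with ((f w - f z) * (g w - g z) + ((f w - f z) * g z + f z * (g w - g z)))%C by ring.
  eapply Rle_lt_trans; [apply Cmod_triangle|].
  eapply Rle_lt_trans; [apply Rplus_le_compat_l, Cmod_triangle|].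
  rewrite !Cmod_mult.
  pose proof (Cmod_ge_0 (f w - f z)); pose proof (Cmod_ge_0 (g w - g z)).
  assert (Cmod (f w - f z) * Cmod (g w - g z) <= h * 1).
  { apply Rmult_le_compat; lra. }
  assert (Cmod (f w - f z) * Cmod (g z) <= h * Cmod (g z))
    by (apply Rmult_le_compat_r; lra).
  assert (Cmod (f z) * Cmod (g w - g z) <= Cmod (f z) * h)
    by (apply Rmult_le_compat_l; lra).
  unfold A in h2; nra.
Qed.

Lemma ccont_opp f z : ccont f z -> ccont (fun w => - f w)%C z.
Proof.
  intros Hf. apply (ccont_local (fun w => - (1) * f w)%C _ z 1); [lra| |].
  - intros w _. ring.
  - apply ccont_mult; [apply ccont_const|exact Hf].
Qed.

Lemma ccont_minus f g z : ccont f z -> ccont g z -> ccont (fun w => f w - g w)%C z.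
Proof. intros Hf Hg; apply ccont_plus; [exact Hf|now apply ccont_opp]. Qed.

Lemma ccont_neq0 f z : ccont f z -> f z <> 0%C -> exists r, 0 < r /\
  forall w, Cmod (w - z) < r -> Cmod (f z) / 2 < Cmod (f w).
Proof.
  intros Hf H0. apply Cmod_gt_0 in H0.
  destruct (Hf (Cmod (f z) / 2)) as [d [Hd H]]; [lra|].
  exists d; split; [exact Hd|]. intros w Hw; specialize (H w Hw).
  pose proof (Cmod_minus_le (f z) (f w)). rewrite Cmod_minus_sym in H. lra.
Qed.

Lemma ccont_inv f z : ccont f z -> f z <> 0%C -> ccont (fun w => / f w)%C z.
Proof.
  intros Hf H0 e He.
  destruct (ccont_neq0 f z Hf H0) as [r [Hr Hn]].
  pose proof (proj1 (Cmod_gt_0 _) H0) as Hm. set (m := Cmod (f z)) in *.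
  destruct (Hf (e * (m * m) / 2)) as [d [Hd H]].
  { apply Rdiv_lt_0_compat; [|lra]. apply Rmult_lt_0_compat; [lra|nra]. }
  exists (Rmin d r); split; [now apply Rmin_glb_lt|]. intros w Hw.
  specialize (H w (Rlt_le_trans _ _ _ Hw (Rmin_l _ _))).
  specialize (Hn w (Rlt_le_trans _ _ _ Hw (Rmin_r _ _))).
  assert (Hw0 : f w <> 0%C) by (apply Cmod_gt_0; lra).
  replace (/ f w - / f z)%C with (- (f w - f z) / (f w * f z))%C by (field; auto).
  rewrite Cmod_div by now apply Cmult_neq_0. rewrite Cmod_opp, Cmod_mult. fold m.
  apply (Rmult_lt_reg_r (Cmod (f w) * m)); [nra|].
  unfold Rdiv; rewrite Rmult_assoc, Rinv_l by nra. rewrite Rmult_1_r.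
  eapply Rlt_trans; [exact H|].
  assert (e * m * (m / 2) < e * m * Cmod (f w)) by (apply Rmult_lt_compat_l; nra).
  nra.
Qed.

Lemma ccont_div f g z : ccont f z -> ccont g z -> g z <> 0%C ->
  ccont (fun w => f w / g w)%C z.
Proof. intros Hf Hg H0; apply ccont_mult; [exact Hf|now apply ccont_inv]. Qed.

Lemma ccont_comp f g z : ccont g z -> ccont f (g z) -> ccont (fun w => f (g w)) z.
Proof.
  intros Hg Hf e He. destruct (Hf e He) as [d [Hd H]].
  destruct (Hg d Hd) as [d' [Hd' H']]. exists d'; split; auto.
Qed.

(** Each rule of differentiation below reduces to naming the factor [q], whose value at [z] is then
    the derivative. *)
Lemma cderiv_caratheodory f q z r :
  0 < r -> ccont q z ->
  (forall w, Cmod (w - z) < r -> (f w - f z = q w * (w - z))%C) ->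
  cderiv f z (q z).
Proof.
  intros Hr Hq H. apply (ccont_local q _ z r Hr); [|exact Hq].
  intros w Hw; unfold slope; destruct (Ceq_dec w z) as [->|Hn]; [reflexivity|].
  rewrite (H w Hw). field. now apply Cminus_neq0.
Qed.

Lemma cderiv_ccont f z l : cderiv f z l -> ccont f z.
Proof.
  intros H. apply (ccont_local (fun w => f z + slope f z l w * (w - z))%C _ z 1); [lra| |].
  - intros w _. rewrite <- slope_mul; ring.
  - apply ccont_plus; [apply ccont_const|]. apply ccont_mult; [exact H|].
    apply ccont_minus; [apply ccont_id|apply ccont_const].
Qed.

Lemma cderiv_local f g z l r :
  0 < r -> (forall w, Cmod (w - z) < r -> f w = g w) -> cderiv f z l -> cderiv g z l.
Proof.
  intros Hr E H. rewrite <- (slope_same f z l). apply (cderiv_caratheodory _ _ _ r Hr H).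
  intros w Hw. rewrite <- !E; auto using slope_mul.
  replace (z - z)%C with (RtoC 0) by ring. now rewrite Cmod_0.
Qed.

Lemma cderiv_const c z : cderiv (fun _ => c) z 0.
Proof.
  apply (cderiv_caratheodory _ (fun _ => RtoC 0) z 1); [lra|apply ccont_const|intros; ring].
Qed.

Lemma cderiv_id z : cderiv (fun w => w) z 1.
Proof.
  apply (cderiv_caratheodory _ (fun _ => RtoC 1) z 1); [lra|apply ccont_const|intros; ring].
Qed.

Lemma cderiv_plus f g z l m :
  cderiv f z l -> cderiv g z m -> cderiv (fun w => f w + g w)%C z (l + m).
Proof.
  intros Hf Hg.
  pose proof (cderiv_caratheodory (fun w => f w + g w)%C
    (fun w => slope f z l w + slope g z m w)%C z 1) as H.
  simpl in H; rewrite !slope_same in H. apply H; [lra|now apply ccont_plus|].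
  intros w _.
  replace (f w + g w - (f z + g z))%C with ((f w - f z) + (g w - g z))%C by ring.
  rewrite (slope_mul f z l), (slope_mul g z m); ring.
Qed.

Lemma cderiv_mult f g z l m :
  cderiv f z l -> cderiv g z m ->
  cderiv (fun w => f w * g w)%C z (l * g z + f z * m).
Proof.
  intros Hf Hg.
  pose proof (cderiv_caratheodory (fun w => f w * g w)%C
    (fun w => slope f z l w * g w + f z * slope g z m w)%C z 1) as H.
  simpl in H; rewrite !slope_same in H. apply H; [lra| |].
  - apply ccont_plus; apply ccont_mult;
      auto using ccont_const; eapply cderiv_ccont; eauto.
  - intros w _.
    replace (f w * g w - f z * g z)%C
      with ((f w - f z) * g w + f z * (g w - g z))%C by ring.
    rewrite (slope_mul f z l), (slope_mul g z m); ring.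
Qed.

Lemma cderiv_inv f z l :
  cderiv f z l -> f z <> 0%C -> cderiv (fun w => / f w)%C z (- l / (f z * f z)).
Proof.
  intros Hf H0. pose proof (cderiv_ccont _ _ _ Hf) as Hc.
  destruct (ccont_neq0 f z Hc H0) as [r [Hr Hn]].
  pose proof (cderiv_caratheodory (fun w => / f w)%C
    (fun w => - slope f z l w / (f w * f z))%C z r) as H.
  simpl in H; rewrite !slope_same in H. apply H; [exact Hr| |].
  - apply ccont_div; [now apply ccont_opp| |now apply Cmult_neq_0].
    apply ccont_mult; [exact Hc|apply ccont_const].
  - intros w Hw. assert (Hw0 : f w <> 0%C).
    { apply Cmod_gt_0. specialize (Hn w Hw). pose proof (Cmod_ge_0 (f z)). lra. }
    replace (/ f w - / f z)%C with (- (f w - f z) / (f w * f z))%C by (field; auto).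
    rewrite (slope_mul f z l). field; auto.
Qed.

Lemma cderiv_comp f g z l m :
  cderiv f (g z) l -> cderiv g z m -> cderiv (fun w => f (g w)) z (l * m).
Proof.
  intros Hf Hg.
  pose proof (cderiv_caratheodory (fun w => f (g w))
    (fun w => slope f (g z) l (g w) * slope g z m w)%C z 1) as H.
  simpl in H; rewrite !slope_same in H. apply H; [lra| |].
  - apply ccont_mult; [|exact Hg].
    apply (ccont_comp (slope f (g z) l) g); [eapply cderiv_ccont; eauto|exact Hf].
  - intros w _. rewrite (slope_mul f (g z) l), (slope_mul g z m); ring.
Qed.

Lemma cderiv_eps f z l : cderiv f z l <->
  forall eps, 0 < eps -> exists delta, 0 < delta /\ forall w, Cmod (w - z) < delta ->
    Cmod (f w - f z - l * (w - z)) <= eps * Cmod (w - z).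
Proof.
  split.
  - intros H e He. destruct (H e He) as [d [Hd Hs]]. exists d; split; [exact Hd|].
    intros w Hw. specialize (Hs w Hw). rewrite slope_same in Hs.
    rewrite (slope_mul f z l).
    replace (slope f z l w * (w - z) - l * (w - z))%C
      with ((slope f z l w - l) * (w - z))%C by ring.
    rewrite Cmod_mult. apply Rmult_le_compat_r; [apply Cmod_ge_0|lra].
  - intros H e He. destruct (H (e / 2)) as [d [Hd Hs]]; [lra|]. exists d; split; [exact Hd|].
    intros w Hw. specialize (Hs w Hw). rewrite slope_same.
    destruct (Ceq_dec w z) as [->|Hn].
    { rewrite slope_same. replace (l - l)%C with (RtoC 0) by ring. rewrite Cmod_0; lra. }
    pose proof (proj1 (Cmod_gt_0 _) (Cminus_neq0 _ _ Hn)) as Hp.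
    rewrite (slope_mul f z l) in Hs.
    replace (slope f z l w * (w - z) - l * (w - z))%C
      with ((slope f z l w - l) * (w - z))%C in Hs by ring.
    rewrite Cmod_mult in Hs. apply Rmult_le_reg_r in Hs; [lra|exact Hp].
Qed.

Lemma cderiv_is_derive f z l : cderiv f z l <-> is_derive (K := C_AbsRing) f z l.
Proof.
  rewrite cderiv_eps; split.
  - intros H; split; [apply is_linear_scal_l|].
    intros x Hx. pose proof (is_filter_lim_locally_unique (V := AbsRing_NormedModule C_AbsRing) z x Hx)
      as E; subst x; clear Hx.
    intros e. destruct (H e (cond_pos e)) as [d [Hd Hs]].
    exists (mkposreal d Hd). intros w Hw.
    change (Cmod (f w - f z - (w - z) * l) <= e * Cmod (w - z)).
    rewrite (Cmult_comm (w - z)). now apply Hs.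
  - intros [_ H] e He.
    destruct (H z (fun P HP => HP) (mkposreal e He)) as [d Hd].
    exists d; split; [apply cond_pos|]. intros w Hw.
    specialize (Hd w Hw).
    change (Cmod (f w - f z - (w - z) * l) <= e * Cmod (w - z)) in Hd.
    now rewrite (Cmult_comm l).
Qed.

(** * Integrals over rectangles *)

(** All integrals run over a real parameter, so C is taken as a normed module over the reals. *)
Notation CInt := (RInt (V := C_R_CompleteNormedModule)).
Notation ex_CInt := (ex_RInt (V := C_R_CompleteNormedModule)).
Notation is_CInt := (is_RInt (V := C_R_CompleteNormedModule)).

Definition pcont (f : R -> C) (t : R) : Prop :=
  forall eps, 0 < eps -> exists delta, 0 < delta /\
    forall s, Rabs (s - t) < delta -> Cmod (f s - f t) < eps.

Lemma pcont_continuous f t :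
  pcont f t -> continuous (U := C_R_CompleteNormedModule) f t.
Proof.
  intros H. apply filterlim_locally. intros e.
  destruct (H e (cond_pos e)) as [d [Hd Hs]]. exists (mkposreal d Hd). intros s Hb.
  apply (C_NormedModule_mixin_compat1 (f t) (f s) e). now apply Hs.
Qed.

Lemma pcont_comp F g t :
  (forall eps, 0 < eps -> exists delta, 0 < delta /\
    forall s, Rabs (s - t) < delta -> Cmod (g s - g t) < eps) ->
  ccont F (g t) -> pcont (fun s => F (g s)) t.
Proof.
  intros Hg HF e He. destruct (HF e He) as [d [Hd H]].
  destruct (Hg d Hd) as [d' [Hd' H']]. exists d'; split; auto.
Qed.

Lemma ex_CInt_pcont f a b : a <= b -> (forall t, a <= t <= b -> pcont f t) -> ex_CInt f a b.
Proof.
  intros Hab H. apply (ex_RInt_continuous (V := C_R_CompleteNormedModule)).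
  intros z Hz. rewrite Rmin_left, Rmax_right in Hz by exact Hab.
  apply pcont_continuous; auto.
Qed.

Lemma norm_C_R (z : C) : norm (V := C_R_NormedModule) z = Cmod z.
Proof.
  unfold norm, Cmod; simpl. unfold prod_norm, norm; simpl. unfold abs; simpl.
  f_equal. rewrite !Rmult_1_r, <- !Rabs_mult. now rewrite !Rabs_pos_eq by nra.
Qed.

Lemma CInt_bound f a b M : a <= b -> ex_CInt f a b ->
  (forall t, a <= t <= b -> Cmod (f t) <= M) -> Cmod (CInt f a b) <= M * (b - a).
Proof.
  intros Hab Hf HM. rewrite Rmult_comm, <- norm_C_R.
  apply (norm_RInt_le_const (V := C_R_NormedModule) f a b (CInt f a b) M Hab).
  { intros t Ht. rewrite norm_C_R. auto. }
  apply (RInt_correct (V := C_R_CompleteNormedModule)); exact Hf.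
Qed.

Lemma is_CInt_scal c f a b l : is_CInt f a b l -> is_CInt (fun t => c * f t)%C a b (c * l)%C.
Proof.
  intros H.
  pose proof (is_RInt_fct_extend_fst (U := R_NormedModule) (V := R_NormedModule) f a b l H) as H1.
  pose proof (is_RInt_fct_extend_snd (U := R_NormedModule) (V := R_NormedModule) f a b l H) as H2.
  apply (is_RInt_fct_extend_pair (U := R_NormedModule) (V := R_NormedModule)).
  - apply (is_RInt_minus (V := R_NormedModule));
      apply (is_RInt_scal (V := R_NormedModule)); assumption.
  - apply (is_RInt_plus (V := R_NormedModule));
      apply (is_RInt_scal (V := R_NormedModule)); assumption.
Qed.

Lemma CInt_scal c f a b : ex_CInt f a b -> CInt (fun t => c * f t)%C a b = (c * CInt f a b)%C.
Proof.
  intros H. apply (is_RInt_unique (V := C_R_CompleteNormedModule)).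
  apply is_CInt_scal, (RInt_correct (V := C_R_CompleteNormedModule)), H.
Qed.

Lemma CInt_plus f g a b : ex_CInt f a b -> ex_CInt g a b ->
  CInt (fun t => f t + g t)%C a b = (CInt f a b + CInt g a b)%C.
Proof. intros Hf Hg. exact (RInt_plus (V := C_R_CompleteNormedModule) f g a b Hf Hg). Qed.

Lemma CInt_minus f g a b : ex_CInt f a b -> ex_CInt g a b ->
  CInt (fun t => f t - g t)%C a b = (CInt f a b - CInt g a b)%C.
Proof. intros Hf Hg. exact (RInt_minus (V := C_R_CompleteNormedModule) f g a b Hf Hg). Qed.

Lemma CInt_const c a b : CInt (fun _ => c) a b = (RtoC (b - a) * c)%C.
Proof.
  rewrite (RInt_const (V := C_R_CompleteNormedModule)).
  destruct c as [x y]. unfold Cmult, scal; simpl. unfold prod_scal, scal, mult; simpl.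
  f_equal; unfold mult; simpl; ring.
Qed.

Lemma CInt_ext f g a b : a <= b -> (forall t, a < t < b -> f t = g t) ->
  CInt f a b = CInt g a b.
Proof.
  intros Hab H. apply (RInt_ext (V := C_R_CompleteNormedModule)).
  rewrite Rmin_left, Rmax_right by exact Hab. exact H.
Qed.

Lemma CInt_Chasles f a b c : ex_CInt f a b -> ex_CInt f b c ->
  CInt f a c = (CInt f a b + CInt f b c)%C.
Proof.
  intros H1 H2. symmetry.
  exact (RInt_Chasles (V := C_R_CompleteNormedModule) f a b c H1 H2).
Qed.

Lemma CInt_affine c0 c1 a b :
  ex_CInt (fun t => c0 + RtoC t * c1)%C a b /\
  CInt (fun t => c0 + RtoC t * c1)%C a b
  = (RtoC (b - a) * c0 + RtoC ((b * b - a * a) / 2) * c1)%C.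
Proof.
  assert (H : is_CInt (fun t => c0 + RtoC t * c1)%C a b
    (RtoC (b - a) * c0 + RtoC ((b * b - a * a) / 2) * c1)%C).
  { destruct c0 as [x y], c1 as [u v].
    assert (P : forall p q, is_RInt (fun t => p + t * q) a b ((b - a) * p + (b * b - a * a) / 2 * q)).
    { intros p q.
      replace ((b - a) * p + (b * b - a * a) / 2 * q)
        with (minus (b * p + b * b / 2 * q) (a * p + a * a / 2 * q))
        by (unfold minus, plus, opp; simpl; field).
      apply (is_RInt_derive (fun t => t * p + t * t / 2 * q)).
      - intros t _. auto_derive; [easy|field].
      - intros t _. apply (ex_derive_continuous (V := R_NormedModule)). now auto_derive. }
    apply (is_RInt_fct_extend_pair (U := R_NormedModule) (V := R_NormedModule)); simpl.
    - eapply is_RInt_ext; [|match goal with |- is_RInt _ _ _ ?l => replace l with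
        ((b - a) * x + (b * b - a * a) / 2 * u) by ring end; apply P].
      intros; simpl; ring.
    - eapply is_RInt_ext; [|match goal with |- is_RInt _ _ _ ?l => replace l with
        ((b - a) * y + (b * b - a * a) / 2 * v) by ring end; apply P].
      intros; simpl; ring. }
  split; [eexists; exact H|].
  now apply (is_RInt_unique (V := C_R_CompleteNormedModule)).
Qed.

(** The contour integral of [H dz] over the boundary of the rectangle, counterclockwise; [Ci] comes
    from [dz = i dy] on the vertical sides. *)
Definition rect (H : C -> C) (a b c d : R) : C :=
  (CInt (fun x => H (x, c)) a b - CInt (fun x => H (x, d)) a b
   + Ci * (CInt (fun y => H (b, y)) c d - CInt (fun y => H (a, y)) c d))%C.

Definition rcont (H : C -> C) a b c d : Prop :=
  forall x y, a <= x <= b -> c <= y <= d -> ccont H (x, y).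

Lemma Cmod_hor x s y : Cmod ((s, y) - (x, y))%C = Rabs (s - x).
Proof.
  replace ((s, y) - (x, y))%C with (RtoC (s - x)); [apply Cmod_R|].
  unfold RtoC, Cminus, Cplus, Copp; simpl; f_equal; ring.
Qed.

Lemma Cmod_ver x s y : Cmod ((x, s) - (x, y))%C = Rabs (s - y).
Proof.
  replace ((x, s) - (x, y))%C with (Ci * RtoC (s - y))%C.
  - rewrite Cmod_mult, Cmod_Ci, Cmod_R; ring.
  - unfold RtoC, Ci, Cminus, Cplus, Cmult, Copp; simpl; f_equal; ring.
Qed.

Lemma ex_CInt_hor H y a b : a <= b -> (forall x, a <= x <= b -> ccont H (x, y)) ->
  ex_CInt (fun x => H (x, y)) a b.
Proof.
  intros Hab HH. apply ex_CInt_pcont; [exact Hab|]. intros t Ht.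
  apply (pcont_comp H (fun x => (x, y))); [|auto].
  intros e He; exists e; split; [exact He|]. intros s Hs. now rewrite Cmod_hor.
Qed.

Lemma ex_CInt_ver H x a b : a <= b -> (forall y, a <= y <= b -> ccont H (x, y)) ->
  ex_CInt (fun y => H (x, y)) a b.
Proof.
  intros Hab HH. apply ex_CInt_pcont; [exact Hab|]. intros t Ht.
  apply (pcont_comp H (fun y => (x, y))); [|auto].
  intros e He; exists e; split; [exact He|]. intros s Hs. now rewrite Cmod_ver.
Qed.

Ltac rect_ex :=
  match goal with
  | |- ex_RInt (fun x => ?H (x, ?y)) _ _ => apply (ex_CInt_hor H y)
  | |- ex_RInt (fun y => ?H (?x, y)) _ _ => apply (ex_CInt_ver H x)
  end;
  [lra | intros; match goal with h : rcont ?H _ _ _ _ |- ccont ?H _ => apply h; lra end].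

(** Each inner edge is traversed twice in opposite directions and cancels, so only the outer sides
    have to be split. *)
Lemma rect_quarter H a m b c n d : a <= m <= b -> c <= n <= d -> rcont H a b c d ->
  rect H a b c d
  = (rect H a m c n + rect H m b c n + (rect H a m n d + rect H m b n d))%C.
Proof.
  intros Hm Hn Hc. unfold rect.
  assert (E1 := CInt_Chasles (fun x => H (x, c)) a m b ltac:(rect_ex) ltac:(rect_ex)).
  assert (E2 := CInt_Chasles (fun x => H (x, d)) a m b ltac:(rect_ex) ltac:(rect_ex)).
  assert (E3 := CInt_Chasles (fun y => H (a, y)) c n d ltac:(rect_ex) ltac:(rect_ex)).
  assert (E4 := CInt_Chasles (fun y => H (b, y)) c n d ltac:(rect_ex) ltac:(rect_ex)).
  rewrite E1, E2, E3, E4. ring.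
Qed.

Lemma rect_plus H K a b c d : a <= b -> c <= d -> rcont H a b c d -> rcont K a b c d ->
  rect (fun z => H z + K z)%C a b c d = (rect H a b c d + rect K a b c d)%C.
Proof.
  intros Hp Hq HH HK. unfold rect.
  rewrite !CInt_plus by rect_ex. ring.
Qed.

Lemma rect_affine A B a b c d : rect (fun z => A + B * z)%C a b c d = RtoC 0.
Proof.
  assert (Eh : forall y, (fun x : R => A + B * (x, y))%C
    = (fun x => (A + B * (Ci * RtoC y)) + RtoC x * B)%C).
  { intros y; apply functional_extensionality; intros x.
    replace ((x, y) : C) with (RtoC x + Ci * RtoC y)%C; [ring|].
    unfold RtoC, Ci, Cplus, Cmult; simpl; f_equal; ring. }
  assert (Ev : forall x, (fun y : R => A + B * (x, y))%C
    = (fun y => (A + B * RtoC x) + RtoC y * (B * Ci))%C).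
  { intros x; apply functional_extensionality; intros y.
    replace ((x, y) : C) with (RtoC x + Ci * RtoC y)%C; [ring|].
    unfold RtoC, Ci, Cplus, Cmult; simpl; f_equal; ring. }
  unfold rect. rewrite !Eh, !Ev, !(proj2 (CInt_affine _ _ _ _)).
  destruct A as [A1 A2], B as [B1 B2].
  unfold RtoC, Ci, Cplus, Cminus, Copp, Cmult; simpl; f_equal; field.
Qed.

Lemma rect_bound H a b c d M : a <= b -> c <= d -> rcont H a b c d ->
  (forall x y, a <= x <= b -> c <= y <= d -> Cmod (H (x, y)) <= M) ->
  Cmod (rect H a b c d) <= 2 * M * ((b - a) + (d - c)).
Proof.
  intros Hp Hq HH HM. unfold rect.
  assert (B1 : Cmod (CInt (fun x => H (x, c)) a b) <= M * (b - a)).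
  { apply CInt_bound; [lra|rect_ex|]. intros; apply HM; lra. }
  assert (B2 : Cmod (CInt (fun x => H (x, d)) a b) <= M * (b - a)).
  { apply CInt_bound; [lra|rect_ex|]. intros; apply HM; lra. }
  assert (B3 : Cmod (CInt (fun y => H (a, y)) c d) <= M * (d - c)).
  { apply CInt_bound; [lra|rect_ex|]. intros; apply HM; lra. }
  assert (B4 : Cmod (CInt (fun y => H (b, y)) c d) <= M * (d - c)).
  { apply CInt_bound; [lra|rect_ex|]. intros; apply HM; lra. }
  assert (T : forall u v, Cmod (u - v) <= Cmod u + Cmod v).
  { intros u v. rewrite <- (Cmod_opp v). apply Cmod_triangle. }
  eapply Rle_trans; [apply Cmod_triangle|].
  rewrite Cmod_mult, Cmod_Ci.
  eapply Rle_trans; [apply Rplus_le_compat; [apply T|apply Rmult_le_compat_l; [lra|apply T]]|].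
  lra.
Qed.

(** * Goursat's theorem *)

Lemma nested_point (x : nat -> R) (h : nat -> R) :
  (forall n, 0 <= h n) -> (forall n, x n <= x (S n) /\ x (S n) + h (S n) <= x n + h n) ->
  exists l, forall n, x n <= l <= x n + h n.
Proof.
  intros Hh Hs.
  assert (Hinc : forall n k, x n <= x (n + k)%nat /\ x (n + k)%nat + h (n + k)%nat <= x n + h n).
  { intros n; induction k as [|k IH]; [rewrite Nat.add_0_r; lra|].
    rewrite <- plus_n_Sm. specialize (Hs (n + k)%nat). lra. }
  assert (Hup : forall n m, x m <= x n + h n).
  { intros n m. destruct (Nat.le_ge_cases n m) as [L|L].
    - replace m with (n + (m - n))%nat by lia. specialize (Hinc n (m - n)%nat).
      specialize (Hh (n + (m - n))%nat). lra.
    - replace n with (m + (n - m))%nat by lia. specialize (Hinc m (n - m)%nat).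
      specialize (Hh (m + (n - m))%nat). lra. }
  destruct (completeness (fun r => exists n, r = x n)) as [l [Hl1 Hl2]].
  - exists (x 0%nat + h 0%nat). intros r [n ->]. apply Hup.
  - now exists (x 0%nat), 0%nat.
  - exists l; intros n; split; [apply Hl1; now exists n|].
    apply Hl2. intros r [m ->]. apply Hup.
Qed.

Lemma cderiv_rcont H a b c d :
  (forall x y, a <= x <= b -> c <= y <= d -> exists l, cderiv H (x, y) l) -> rcont H a b c d.
Proof. intros HH x y Hx Hy. destruct (HH x y Hx Hy) as [l Hl]. eapply cderiv_ccont, Hl. Qed.

Lemma Cmod_le_add (x y u v : R) : Cmod ((x, y) - (u, v)) <= Rabs (x - u) + Rabs (y - v).
Proof.
  replace ((x, y) - (u, v))%C with (((x, y) - (u, y)) + ((u, y) - (u, v)))%C by ring.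
  rewrite <- (Cmod_hor u x y), <- (Cmod_ver u y v). apply Cmod_triangle.
Qed.

(** The affine approximation at [(x0, y0)] has boundary integral 0. The remainder is at most
    [eps / 2 * (h + k)] on a rectangle of perimeter [2 * (h + k)], where [h + k] also bounds the
    distance to [(x0, y0)]. *)
Lemma rect_small H x0 y0 l : cderiv H (x0, y0) l -> forall eps, 0 < eps ->
  exists delta, 0 < delta /\ forall x h y k, 0 <= h -> 0 <= k -> h + k < delta ->
    x <= x0 <= x + h -> y <= y0 <= y + k -> rcont H x (x + h) y (y + k) ->
    Cmod (rect H x (x + h) y (y + k)) <= eps * (h + k) ^ 2.
Proof.
  intros Hl e He. destruct (proj1 (cderiv_eps _ _ _) Hl (e / 2)) as [d [Hd Hs]]; [lra|].
  exists d; split; [exact Hd|]. intros x h y k Hh Hk Hhk Hx Hy Hc.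
  set (z0 := (x0, y0) : C). set (A := (H z0 - l * z0)%C).
  set (rho := fun z => (H z - (A + l * z))%C).
  assert (Ha : forall z, ccont (fun z => A + l * z)%C z).
  { intros z. apply ccont_plus; [apply ccont_const|].
    apply ccont_mult; [apply ccont_const|apply ccont_id]. }
  assert (Hr : rcont rho x (x + h) y (y + k)).
  { intros u v Hu Hv. unfold rho. apply ccont_minus; [now apply Hc|apply Ha]. }
  replace H with (fun z => (A + l * z) + rho z)%C.
  2:{ apply functional_extensionality. intros z; unfold rho; ring. }
  rewrite rect_plus; [|lra|lra|now intros u v _ _; apply Ha|exact Hr].
  rewrite rect_affine, Cplus_0_l.
  replace (e * (h + k) ^ 2) with (2 * (e / 2 * (h + k)) * ((x + h - x) + (y + k - y))) by field.
  apply rect_bound; [lra|lra|exact Hr|]. intros u v Hu Hv.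
  assert (Hd1 : Cmod ((u, v) - (x0, y0)) <= h + k).
  { eapply Rle_trans; [apply Cmod_le_add|].
    apply Rplus_le_compat; apply Rabs_le; lra. }
  unfold rho, A. replace (H (u, v) - (H z0 - l * z0 + l * (u, v)))%C
    with (H (u, v) - H z0 - l * ((u, v) - z0))%C by ring.
  eapply Rle_trans; [apply Hs; unfold z0; lra|].
  apply Rmult_le_compat_l; [lra|exact Hd1].
Qed.

(** A bound proportional to the area is stable under quartering: if it fails on a rectangle, it
    fails with the same [eps] on one of the quarters. The quarters shrink to a point, where
    [rect_small] contradicts the failure. *)
Lemma goursat_bound H a c p q eps : 0 < p -> 0 < q -> 0 < eps ->
  (forall x y, a <= x <= a + p -> c <= y <= c + q -> exists l, cderiv H (x, y) l) ->
  Cmod (rect H a (a + p) c (c + q)) <= eps * (p * q).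
Proof.
  intros Hp Hq He HH. apply Rnot_lt_le. intros Hbad.
  pose proof (cderiv_rcont _ _ _ _ _ HH) as Hc.
  set (h := fun n : nat => p * (/ 2) ^ n). set (k := fun n : nat => q * (/ 2) ^ n).
  assert (Hpow : forall n, 0 < (/ 2) ^ n) by (intros; apply pow_lt; lra).
  assert (Hh : forall n, 0 < h n) by (intros; apply Rmult_lt_0_compat; auto).
  assert (Hk : forall n, 0 < k n) by (intros; apply Rmult_lt_0_compat; auto).
  assert (HhS : forall n, h n = h (S n) + h (S n)) by (intros; unfold h; simpl; field).
  assert (HkS : forall n, k n = k (S n) + k (S n)) by (intros; unfold k; simpl; field).
  set (I := fun n (s : R * R) =>
    a <= fst s /\ fst s + h n <= a + p /\ c <= snd s /\ snd s + k n <= c + q /\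
    eps * (h n * k n) < Cmod (rect H (fst s) (fst s + h n) (snd s) (snd s + k n))).
  set (N := fun n (s s' : R * R) =>
    (fst s <= fst s' /\ fst s' + h (S n) <= fst s + h n) /\
    (snd s <= snd s' /\ snd s' + k (S n) <= snd s + k n)).
  (* The hypothesis [I n s] stands under the existential so that the choice of [s'] is a total
     function, as the recursion needs. *)
  assert (Hstep : forall n s, exists s', I n s -> I (S n) s' /\ N n s s').
  { intros n s. destruct (classic (I n s)) as [Hs|Hs]; [|exists s; tauto].
    destruct s as [x y]; destruct Hs as [H1 [H2 [H3 [H4 H5]]]]; simpl in *.
    pose proof (Hh (S n)); pose proof (Hk (S n)); pose proof (HhS n); pose proof (HkS n).
    set (h' := h (S n)) in *; set (k' := k (S n)) in *.
    rewrite (rect_quarter H x (x + h') (x + h n) y (y + k') (y + k n)) in H5;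
      [|lra|lra|intros u v Hu Hv; apply Hc; lra].
    replace (x + h n) with ((x + h') + h') in H5 by lra.
    replace (y + k n) with ((y + k') + k') in H5 by lra.
    set (m := eps * (h' * k')).
    assert (Em : eps * (h n * k n) = m + m + (m + m)).
    { unfold m. rewrite HhS, HkS. fold h' k'. ring. }
    assert (HQ : forall x' y', (x' = x \/ x' = x + h') -> (y' = y \/ y' = y + k') ->
      (exists s', I n (x, y) -> I (S n) s' /\ N n (x, y) s') \/
      Cmod (rect H x' (x' + h') y' (y' + k')) <= m).
    { intros x' y' Hx' Hy'. destruct (Rle_lt_dec (Cmod (rect H x' (x' + h') y' (y' + k'))) m) as [L|L].
      - now right.
      - left. exists (x', y'); intros _; unfold I, N; simpl; fold h' k'.
        destruct Hx' as [-> | ->], Hy' as [-> | ->]; fold m; repeat split; lra. }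
    destruct (HQ x y) as [Q|Q1]; auto.
    destruct (HQ (x + h') y) as [Q|Q2]; auto.
    destruct (HQ x (y + k')) as [Q|Q3]; auto.
    destruct (HQ (x + h') (y + k')) as [Q|Q4]; auto.
    exfalso. rewrite Em in H5.
    eapply Rlt_not_le; [exact H5|].
    eapply Rle_trans; [apply Cmod_triangle|].
    apply Rplus_le_compat; (eapply Rle_trans; [apply Cmod_triangle|]); lra. }
  set (next := fun n s => proj1_sig (constructive_indefinite_description _ (Hstep n s))).
  set (s := fix s n := match n with O => (a, c) | S m => next m (s m) end).
  assert (HI : forall n, I n (s n)).
  { induction n as [|n IH].
    - unfold I; simpl. unfold h, k; simpl. rewrite !Rmult_1_r. repeat split; lra.
    - simpl. unfold next. destruct (constructive_indefinite_description _ _) as [s' Hs']; simpl.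
      now apply Hs'. }
  assert (HN : forall n, N n (s n) (s (S n))).
  { intros n. simpl. unfold next. destruct (constructive_indefinite_description _ _) as [s' Hs']; simpl.
    now apply Hs'. }
  destruct (nested_point (fun n => fst (s n)) h) as [x0 Hx0].
  { intros n; specialize (Hh n); lra. } { intros n; apply (HN n). }
  destruct (nested_point (fun n => snd (s n)) k) as [y0 Hy0].
  { intros n; specialize (Hk n); lra. } { intros n; apply (HN n). }
  assert (Hin : forall n, a <= fst (s n) /\ fst (s n) + h n <= a + p /\
     c <= snd (s n) /\ snd (s n) + k n <= c + q).
  { intros n; destruct (HI n) as [? [? [? [? _]]]]; auto. }
  destruct (HH x0 y0) as [l Hl].
  { specialize (Hin O); specialize (Hx0 O); lra. } { specialize (Hin O); specialize (Hy0 O); lra. }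
  (* All the rectangles are similar, so this [eta] turns [eta * (h n + k n) ^ 2] into half of
     [eps * (h n * k n)] at every scale. *)
  set (eta := eps * (p * q) / (2 * (p + q) ^ 2)).
  assert (Heta : 0 < eta).
  { unfold eta. apply Rdiv_lt_0_compat; [|nra]. apply Rmult_lt_0_compat; nra. }
  destruct (rect_small H x0 y0 l Hl eta Heta) as [d [Hd Hs]].
  destruct (pow_lt_1_zero (/ 2) ltac:(rewrite Rabs_pos_eq; lra) (d / (p + q))
    ltac:(apply Rdiv_lt_0_compat; lra)) as [n Hn].
  specialize (Hn n (le_n n)). rewrite Rabs_pos_eq in Hn by (apply Rlt_le, Hpow).
  specialize (Hs (fst (s n)) (h n) (snd (s n)) (k n)).
  assert (Hsum : h n + k n = (p + q) * (/ 2) ^ n) by (unfold h, k; ring).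
  assert (Hlt : h n + k n < d).
  { rewrite Hsum. apply (Rmult_lt_compat_l (p + q)) in Hn; [|lra].
    replace ((p + q) * (d / (p + q))) with d in Hn by (field; lra). exact Hn. }
  specialize (Hs (Rlt_le _ _ (Hh n)) (Rlt_le _ _ (Hk n)) Hlt (Hx0 n) (Hy0 n)).
  specialize (Hin n). destruct (HI n) as [_ [_ [_ [_ HB]]]].
  assert (eta * (h n + k n) ^ 2 = eps * (h n * k n) / 2).
  { rewrite Hsum. unfold eta, h, k. field. lra. }
  assert (0 < eps * (h n * k n)).
  { specialize (Hh n); specialize (Hk n). apply Rmult_lt_0_compat; [|nra]. lra. }
  assert (rcont H (fst (s n)) (fst (s n) + h n) (snd (s n)) (snd (s n) + k n)).
  { intros u v Hu Hv; apply Hc; lra. }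
  specialize (Hs H2). lra.
Qed.

(** With [eps] equal to the modulus of the integral divided by twice the area, the bound says that
    this modulus is at most its own half. *)
Lemma goursat H a b c d : a < b -> c < d ->
  (forall x y, a <= x <= b -> c <= y <= d -> exists l, cderiv H (x, y) l) ->
  rect H a b c d = RtoC 0.
Proof.
  intros Hab Hcd HH. apply Cmod_eq_0. apply Rle_antisym; [|apply Cmod_ge_0].
  apply Rnot_lt_le. intros L.
  set (A := (b - a) * (d - c)). assert (HA : 0 < A) by (unfold A; nra).
  replace b with (a + (b - a)) in * by ring. replace d with (c + (d - c)) in * by ring.
  pose proof (goursat_bound H a c (b - a) (d - c)
    (Cmod (rect H a (a + (b - a)) c (c + (d - c))) / (2 * A))) as G.
  fold A in G.
  replace (Cmod (rect H a (a + (b - a)) c (c + (d - c))) / (2 * A) * A)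
    with (Cmod (rect H a (a + (b - a)) c (c + (d - c))) / 2) in G by (field; lra).
  assert (0 < Cmod (rect H a (a + (b - a)) c (c + (d - c))) / (2 * A))
    by (apply Rdiv_lt_0_compat; lra).
  assert (0 < b - a) by lra. assert (0 < d - c) by lra.
  specialize (G H1 H2 H0 HH). lra.
Qed.

(** * The complex exponential and integrals over circles *)

Definition cis (t : R) : C := (cos t, sin t).
Lemma exp_le_exp x y : x <= y -> exp x <= exp y.
Proof. intros [H| ->]; [now apply Rlt_le, exp_increasing|lra]. Qed.

Definition cexp (z : C) : C := (RtoC (exp (fst z)) * cis (snd z))%C.

Lemma Cmod_cis t : Cmod (cis t) = 1.
Proof.
  unfold Cmod, cis; simpl. rewrite !Rmult_1_r.
  pose proof (sin2_cos2 t) as H; unfold Rsqr in H.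
  replace (cos t * cos t + sin t * sin t) with 1 by lra. apply sqrt_1.
Qed.

Lemma Cmod_cexp z : Cmod (cexp z) = exp (fst z).
Proof.
  unfold cexp. rewrite Cmod_mult, Cmod_R, Cmod_cis, Rmult_1_r.
  apply Rabs_pos_eq, Rlt_le, exp_pos.
Qed.

Lemma cexp_plus z w : cexp (z + w) = (cexp z * cexp w)%C.
Proof.
  destruct z as [x y], w as [u v]. unfold cexp, cis; simpl.
  rewrite exp_plus, cos_plus, sin_plus.
  unfold Cmult, RtoC; simpl; f_equal; ring.
Qed.

Lemma Cmod_le_pair (x y : R) : Cmod (x, y) <= Rabs x + Rabs y.
Proof.
  pose proof (Cmod_le_add x y 0 0) as H. rewrite !Rminus_0_r in H.
  replace ((x, y) - (0, 0))%C with ((x, y) : C) in H; [exact H|].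
  unfold Cminus, Cplus, Copp; simpl; f_equal; ring.
Qed.

Lemma Rabs_fst_le (z : C) : Rabs (fst z) <= Cmod z.
Proof. eapply Rle_trans; [apply Rmax_l|apply Rmax_Cmod]. Qed.

Lemma Rabs_snd_le (z : C) : Rabs (snd z) <= Cmod z.
Proof. eapply Rle_trans; [apply Rmax_r|apply Rmax_Cmod]. Qed.

Lemma is_derive_eps (f : R -> R) x l : is_derive f x l -> forall eps, 0 < eps ->
  exists delta, 0 < delta /\ forall y, Rabs (y - x) < delta ->
    Rabs (f y - f x - l * (y - x)) <= eps * Rabs (y - x).
Proof.
  intros [_ H] e He. destruct (H x (fun P HP => HP) (mkposreal e He)) as [d Hd].
  exists d; split; [apply cond_pos|]. intros y Hy. specialize (Hd y Hy).
  change (Rabs (f y - f x - (y - x) * l) <= e * Rabs (y - x)) in Hd.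
  now rewrite (Rmult_comm l).
Qed.

(** The first-order remainders [p], [c], [s] of the real functions [exp], [cos], [sin] express the
    complex remainder as a polynomial each of whose terms is small compared with the modulus. *)
Lemma cderiv_cexp_0 : cderiv cexp 0 1.
Proof.
  apply cderiv_eps. intros e0 He0.
  (* The 8 pays for two components, each at most [4 * (e * m)]; the minimum with 1 keeps the
     quadratic terms under control. *)
  set (e := Rmin 1 e0 / 8).
  assert (He : 0 < e) by (unfold e; pose proof (Rmin_glb_lt 1 e0 0 ltac:(lra) He0); lra).
  assert (He1 : e <= 1 / 8) by (unfold e; pose proof (Rmin_l 1 e0); lra).
  assert (He2 : 8 * e <= e0) by (unfold e; pose proof (Rmin_r 1 e0); lra).
  destruct (is_derive_eps exp 0 _ (is_derive_exp 0) e He) as [d1 [Hd1 H1]].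
  destruct (is_derive_eps sin 0 _ (is_derive_sin 0) e He) as [d2 [Hd2 H2]].
  destruct (is_derive_eps cos 0 _ (is_derive_cos 0) e He) as [d3 [Hd3 H3]].
  rewrite exp_0 in H1. rewrite sin_0, cos_0 in H2. rewrite sin_0, cos_0 in H3.
  exists (Rmin e (Rmin d1 (Rmin d2 d3))). split.
  { repeat apply Rmin_glb_lt; assumption. }
  intros [x y] Hw.
  replace ((x, y) - 0)%C with ((x, y) : C) in * by
    (unfold Cminus, Cplus, Copp, RtoC; simpl; f_equal; ring).
  pose proof (Rabs_fst_le (x, y)) as Hx; pose proof (Rabs_snd_le (x, y)) as Hy; simpl in Hx, Hy.
  set (m := Cmod (x, y)) in *.
  apply Rmin_Rgt in Hw as [G0 Hw]; apply Rmin_Rgt in Hw as [G1 Hw]; apply Rmin_Rgt in Hw as [G2 G3].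
  specialize (H1 x ltac:(rewrite Rminus_0_r; lra)).
  specialize (H2 y ltac:(rewrite Rminus_0_r; lra)).
  specialize (H3 y ltac:(rewrite Rminus_0_r; lra)).
  rewrite !Rminus_0_r in *.
  set (p := exp x - 1 - 1 * x) in *. set (c := cos y - 1 - - 0 * y) in *.
  set (s := sin y - 1 * y) in *.
  assert (E : (cexp (x, y) - cexp 0 - 1 * (x, y))%C
    = (p * (1 + c) + x * c + c, p * (y + s) + x * (y + s) + s)).
  { unfold cexp, cis, RtoC, Cminus, Cplus, Copp, Cmult; simpl.
    rewrite exp_0, sin_0, cos_0.
    assert (Ep : exp x = 1 + x + p) by (unfold p; ring).
    assert (Ec : cos y = 1 + c) by (unfold c; ring).
    assert (Es : sin y = y + s) by (unfold s; ring).
    rewrite Ep, Ec, Es. f_equal; ring. }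
  rewrite E. eapply Rle_trans; [apply Cmod_le_pair|].
  assert (Hm : 0 <= m) by apply Cmod_ge_0.
  assert (Bp : Rabs p <= e * m) by (eapply Rle_trans; [exact H1|]; apply Rmult_le_compat_l; lra).
  assert (Bc : Rabs c <= e * m) by (eapply Rle_trans; [exact H3|]; apply Rmult_le_compat_l; lra).
  assert (Bs : Rabs s <= e * m) by (eapply Rle_trans; [exact H2|]; apply Rmult_le_compat_l; lra).
  assert (Bem : 0 <= e * m <= e / 4) by nra.
  assert (T1 : Rabs (p * (1 + c) + x * c + c) <= 4 * (e * m)).
  { eapply Rle_trans; [apply Rabs_triang|].
    eapply Rle_trans; [apply Rplus_le_compat_r, Rabs_triang|]. rewrite !Rabs_mult.
    assert (Rabs (1 + c) <= 2).
    { eapply Rle_trans; [apply Rabs_triang|]. rewrite Rabs_R1. lra. }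
    assert (Rabs p * Rabs (1 + c) <= (e * m) * 2) by
      (apply Rmult_le_compat; auto using Rabs_pos).
    assert (Rabs x * Rabs c <= 1 * (e * m)) by
      (apply Rmult_le_compat; auto using Rabs_pos; lra).
    lra. }
  assert (Bys : Rabs (y + s) <= 2 * m).
  { eapply Rle_trans; [apply Rabs_triang|]. nra. }
  assert (T2 : Rabs (p * (y + s) + x * (y + s) + s) <= 4 * (e * m)).
  { eapply Rle_trans; [apply Rabs_triang|].
    eapply Rle_trans; [apply Rplus_le_compat_r, Rabs_triang|]. rewrite !Rabs_mult.
    assert (Rabs p * Rabs (y + s) <= (e * m) * 1) by
      (apply Rmult_le_compat; auto using Rabs_pos; lra).
    assert (Rabs x * Rabs (y + s) <= e * (2 * m)) by
      (apply Rmult_le_compat; auto using Rabs_pos; lra).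
    lra. }
  assert (e * m * 8 <= e0 * m) by (rewrite (Rmult_comm e m), Rmult_assoc, Rmult_comm;
    apply Rmult_le_compat_r; lra).
  lra.
Qed.

Lemma cderiv_cexp z : cderiv cexp z (cexp z).
Proof.
  assert (Hsub : cderiv (fun w => w + - z)%C z (1 + 0)).
  { apply cderiv_plus; [apply cderiv_id|apply cderiv_const]. }
  pose proof (cderiv_comp cexp (fun w => w + - z)%C z 1 (1 + 0)) as Hc; simpl in Hc.
  replace (z + - z)%C with (RtoC 0) in Hc by ring.
  specialize (Hc cderiv_cexp_0 Hsub).
  pose proof (cderiv_mult _ _ z _ _ (cderiv_const (cexp z) z) Hc) as Hm; simpl in Hm.
  match type of Hm with cderiv _ _ ?l => replace l with (cexp z) in Hm by ring end.
  apply (cderiv_local (fun w => cexp z * cexp (w + - z))%C _ _ _ 1 Rlt_0_1); [|exact Hm].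
  intros w _. rewrite <- cexp_plus. f_equal; ring.
Qed.

(* With respect to the angle dt, not dz. *)
Definition cint (F : C -> C) (r : R) : C := CInt (fun t => F (RtoC r * cis t)%C) 0 (2 * PI).

Lemma cis_cont t : forall eps, 0 < eps -> exists delta, 0 < delta /\
  forall s, Rabs (s - t) < delta -> Cmod (cis s - cis t) < eps.
Proof.
  intros e He.
  destruct (proj1 (continuity_pt_locally cos t) (continuity_cos t) (mkposreal (e / 2) ltac:(lra)))
    as [d1 H1].
  destruct (proj1 (continuity_pt_locally sin t) (continuity_sin t) (mkposreal (e / 2) ltac:(lra)))
    as [d2 H2].
  exists (Rmin d1 d2); split; [apply Rmin_glb_lt; apply cond_pos|]. intros s Hs.
  apply Rmin_Rgt in Hs as [G1 G2].
  specialize (H1 s G1); specialize (H2 s G2); simpl in H1, H2.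
  eapply Rle_lt_trans; [apply Cmod_le_add|]. lra.
Qed.

Lemma Cmod_polar r t : 0 <= r -> Cmod (RtoC r * cis t) = r.
Proof. intros Hr. now rewrite Cmod_mult, Cmod_R, Cmod_cis, Rmult_1_r, Rabs_pos_eq. Qed.

Lemma pcont_polar F r t : ccont F (RtoC r * cis t) -> pcont (fun t => F (RtoC r * cis t)%C) t.
Proof.
  intros HF. apply (pcont_comp F (fun t => RtoC r * cis t)%C); [|exact HF].
  intros e He. pose proof (Rabs_pos r).
  destruct (cis_cont t (e / (Rabs r + 1))) as [d [Hd Hs]].
  { apply Rdiv_lt_0_compat; lra. }
  exists d; split; [exact Hd|]. intros s Hst; specialize (Hs s Hst).
  replace (RtoC r * cis s - RtoC r * cis t)%C with (RtoC r * (cis s - cis t))%C by ring.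
  rewrite Cmod_mult, Cmod_R. pose proof (Cmod_ge_0 (cis s - cis t)).
  replace e with ((Rabs r + 1) * (e / (Rabs r + 1))) by (field; lra). nra.
Qed.

Lemma ex_cint F r : (forall t, ccont F (RtoC r * cis t)) ->
  ex_CInt (fun t => F (RtoC r * cis t)%C) 0 (2 * PI).
Proof.
  intros HF. apply ex_CInt_pcont; [pose proof PI_RGT_0; lra|]. intros t _. now apply pcont_polar.
Qed.

Lemma cint_0 F : cint F 0 = (RtoC (2 * PI) * F 0)%C.
Proof.
  unfold cint. rewrite (CInt_ext _ (fun _ => F 0)).
  - rewrite CInt_const. f_equal. f_equal. ring.
  - pose proof PI_RGT_0; lra.
  - intros t _. f_equal. ring.
Qed.

Lemma cint_bound F r M : (forall t, ccont F (RtoC r * cis t)) ->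
  (forall t, 0 <= t <= 2 * PI -> Cmod (F (RtoC r * cis t)%C) <= M) ->
  Cmod (cint F r) <= 2 * PI * M.
Proof.
  intros HF HM. replace (2 * PI * M) with (M * (2 * PI - 0)) by ring.
  apply CInt_bound; [pose proof PI_RGT_0; lra|now apply ex_cint|auto].
Qed.

Lemma cint_const F r1 r2 : 0 < r1 < r2 ->
  (forall z, r1 <= Cmod z <= r2 -> exists l, cderiv F z l) -> cint F r1 = cint F r2.
Proof.
  intros [H0 H12] HF. set (H := fun z => F (cexp z)).
  assert (G : rect H (ln r1) (ln r2) 0 (2 * PI) = RtoC 0).
  { apply goursat; [now apply ln_increasing|pose proof PI_RGT_0; lra|].
    intros x y Hx _. destruct (HF (cexp (x, y))) as [l Hl].
    - rewrite Cmod_cexp; simpl. rewrite <- (exp_ln r1), <- (exp_ln r2) by lra.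
      split; apply exp_le_exp; lra.
    - eexists. apply (cderiv_comp F cexp); [exact Hl|apply cderiv_cexp]. }
  unfold rect in G.
  assert (E0 : CInt (fun x => H (x, 2 * PI)) (ln r1) (ln r2) = CInt (fun x => H (x, 0)) (ln r1) (ln r2)).
  { f_equal. apply functional_extensionality. intros x.
    unfold H, cexp, cis; simpl. now rewrite cos_2PI, sin_2PI, cos_0, sin_0. }
  assert (Er : forall r, 0 < r -> CInt (fun y => H (ln r, y)) 0 (2 * PI) = cint F r).
  { intros r Hr. unfold cint. f_equal. apply functional_extensionality.
    intros y. unfold H, cexp; simpl. now rewrite exp_ln. }
  rewrite E0, !Er in G by lra.
  assert (E : (Ci * (cint F r2 - cint F r1))%C = RtoC 0) by (rewrite <- G; ring).
  destruct (Ceq_dec (cint F r1) (cint F r2)) as [|N]; [assumption|exfalso].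
  apply (f_equal Cmod) in E. rewrite Cmod_mult, Cmod_Ci, Cmod_0, Rmult_1_l in E.
  apply Cmod_eq_0 in E. apply N. rewrite <- (Cplus_0_l (cint F r1)), <- E. ring.
Qed.

(** * Cauchy's formula *)

(** [G] stands for the real or the imaginary part: the uniform continuity theorem applied below
    concerns real-valued functions of two variables. *)
Lemma ccont_polar_2d F G r t :
  (forall z, Rabs (G z) <= Cmod z) -> (forall z w, G (z - w)%C = G z - G w) ->
  ccont F (RtoC r * cis t) -> continuity_2d_pt (fun v u => G (F (RtoC v * cis u)%C)) r t.
Proof.
  intros HG Hsub HF e. destruct (HF e (cond_pos e)) as [d [Hd H]].
  pose proof (Rabs_pos r).
  destruct (cis_cont t (d / (2 * (Rabs r + 1)))) as [d' [Hd' H']].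
  { apply Rdiv_lt_0_compat; lra. }
  exists (mkposreal (Rmin (d / 2) d') ltac:(apply Rmin_glb_lt; lra)). intros v u Hv Hu; simpl in *.
  apply Rmin_Rgt in Hv as [Hv _]; apply Rmin_Rgt in Hu as [_ Hu].
  specialize (H' u Hu). rewrite <- Hsub.
  eapply Rle_lt_trans; [apply HG|]. apply H.
  replace (RtoC v * cis u - RtoC r * cis t)%C
    with (RtoC (v - r) * cis u + RtoC r * (cis u - cis t))%C by (rewrite RtoC_minus; ring).
  eapply Rle_lt_trans; [apply Cmod_triangle|].
  rewrite !Cmod_mult, !Cmod_R, Cmod_cis.
  pose proof (Cmod_ge_0 (cis u - cis t)).
  assert (Rabs r * Cmod (cis u - cis t) <= d / 2).
  { replace (d / 2) with ((Rabs r + 1) * (d / (2 * (Rabs r + 1)))) by (field; lra). nra. }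
  lra.
Qed.

Lemma cint_minus F G r : (forall t, ccont F (RtoC r * cis t)) ->
  (forall t, ccont G (RtoC r * cis t)) ->
  cint (fun z => F z - G z)%C r = (cint F r - cint G r)%C.
Proof. intros HF HG. unfold cint. apply CInt_minus; now apply ex_cint. Qed.

Lemma cint_scal c F r : (forall t, ccont F (RtoC r * cis t)) ->
  cint (fun z => c * F z)%C r = (c * cint F r)%C.
Proof. intros HF. unfold cint. apply CInt_scal; now apply ex_cint. Qed.

Lemma cint_ext F G r : (forall z, Cmod z = r -> F z = G z) -> 0 <= r -> cint F r = cint G r.
Proof.
  intros H Hr. unfold cint. f_equal. apply functional_extensionality.
  intros t. apply H. now apply Cmod_polar.
Qed.

Lemma cint_cont F rad r : (forall z, Cmod z < rad -> ccont F z) -> 0 <= r < rad ->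
  forall eps, 0 < eps -> exists delta, 0 < delta /\ forall rho, 0 <= rho < rad ->
    Rabs (rho - r) < delta -> Cmod (cint F rho - cint F r) <= eps.
Proof.
  intros HF Hr e He. pose proof PI_RGT_0 as Hpi.
  assert (Hc : forall rho t, 0 <= rho < rad -> ccont F (RtoC rho * cis t)).
  { intros rho t Hrho. apply HF. rewrite Cmod_polar; lra. }
  assert (He' : 0 < e / (4 * PI)) by (apply Rdiv_lt_0_compat; lra).
  destruct (uniform_continuity_2d_1d' (fun v u => Re (F (RtoC v * cis u)%C)) 0 (2 * PI) r)
    with (eps := mkposreal _ He') as [d1 H1].
  { intros t _. apply ccont_polar_2d; [apply Rabs_fst_le|intros; reflexivity|now apply Hc]. }
  destruct (uniform_continuity_2d_1d' (fun v u => Im (F (RtoC v * cis u)%C)) 0 (2 * PI) r)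
    with (eps := mkposreal _ He') as [d2 H2].
  { intros t _. apply ccont_polar_2d; [apply Rabs_snd_le|intros; reflexivity|now apply Hc]. }
  pose proof (cond_pos d1); pose proof (cond_pos d2).
  exists (Rmin d1 d2); split; [now apply Rmin_glb_lt|]. intros rho Hrho Hd.
  apply Rmin_Rgt in Hd as [G1 G2].
  apply Rabs_def2 in G1; apply Rabs_def2 in G2.
  unfold cint. rewrite <- CInt_minus by (apply ex_cint; auto).
  replace e with (e / (2 * PI) * (2 * PI - 0)) by (field; lra).
  apply CInt_bound; [lra| |].
  { apply (ex_RInt_minus (V := C_R_NormedModule)); apply ex_cint; auto. }
  intros t Ht.
  assert (Z : Rabs (t - t) = 0) by (rewrite Rminus_diag; apply Rabs_R0).
  specialize (H1 t r t rho ltac:(lra) ltac:(lra) ltac:(lra) ltac:(lra) ltac:(rewrite Z; lra)).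
  specialize (H2 t r t rho ltac:(lra) ltac:(lra) ltac:(lra) ltac:(lra) ltac:(rewrite Z; lra)).
  simpl in H1, H2. unfold Re, Im in *.
  destruct (F (RtoC rho * cis t)%C) as [x y], (F (RtoC r * cis t)%C) as [u v].
  eapply Rle_trans; [apply Cmod_le_add|].
  replace (e / (2 * PI)) with (e / (4 * PI) + e / (4 * PI)) by (field; lra). simpl in *; lra.
Qed.

(** Goursat's theorem only reaches circles near which the integrand is differentiable; continuity in
    the radius carries the equality to the two excluded ends. *)
Lemma const_closure (J : R -> C) rad r1 r2 : 0 <= r1 < r2 -> r2 < rad ->
  (forall r, 0 <= r < rad -> forall eps, 0 < eps -> exists delta, 0 < delta /\
     forall rho, 0 <= rho < rad -> Rabs (rho - r) < delta -> Cmod (J rho - J r) <= eps) ->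
  (forall x y, r1 < x < y -> y < r2 -> J x = J y) -> J r1 = J r2.
Proof.
  intros H1 H2 Hc Hconst.
  destruct (Ceq_dec (J r1) (J r2)) as [|N]; [assumption|exfalso].
  apply Cminus_neq0, Cmod_gt_0 in N. set (m := Cmod (J r1 - J r2)) in *.
  destruct (Hc r1 ltac:(lra) (m / 3) ltac:(lra)) as [d1 [Hd1 C1]].
  destruct (Hc r2 ltac:(lra) (m / 3) ltac:(lra)) as [d2 [Hd2 C2]].
  set (h := Rmin (Rmin d1 d2) (r2 - r1) / 3).
  assert (Hh : 0 < h) by (unfold h; pose proof (Rmin_glb_lt (Rmin d1 d2) (r2 - r1) 0
    ltac:(now apply Rmin_glb_lt) ltac:(lra)); lra).
  assert (L0 : 3 * h <= r2 - r1) by (unfold h; pose proof (Rmin_r (Rmin d1 d2) (r2 - r1)); lra).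
  assert (L1 : 3 * h <= Rmin d1 d2) by (unfold h; pose proof (Rmin_l (Rmin d1 d2) (r2 - r1)); lra).
  pose proof (Rmin_l d1 d2); pose proof (Rmin_r d1 d2).
  specialize (C1 (r1 + h) ltac:(lra)); specialize (C2 (r2 - h) ltac:(lra)).
  replace (r1 + h - r1) with h in C1 by ring. replace (r2 - h - r2) with (- h) in C2 by ring.
  rewrite Rabs_Ropp in C2. rewrite Rabs_pos_eq in C1, C2 by lra.
  specialize (C1 ltac:(lra)); specialize (C2 ltac:(lra)).
  rewrite (Hconst (r1 + h) (r2 - h)) in C1 by lra.
  pose proof (Cmod_triangle (J r1 - J (r2 - h)) (J (r2 - h) - J r2)) as T.
  replace (J r1 - J (r2 - h)%R + (J (r2 - h)%R - J r2))%C with (J r1 - J r2)%C in T by ring.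
  fold m in T. rewrite Cmod_minus_sym in C1. lra.
Qed.

(* Riemann's removability is built in: continuity suffices at 0 and on one circle. *)
Lemma mean_value F rad rho r :
  (forall z, Cmod z < rad -> ccont F z) ->
  (forall z, 0 < Cmod z < rad -> Cmod z <> rho -> exists l, cderiv F z l) ->
  0 <= r < rad -> cint F r = (RtoC (2 * PI) * F 0)%C.
Proof.
  intros Hc Hd Hr. rewrite <- cint_0. symmetry.
  assert (HJ := fun r Hr => cint_cont F rad r Hc Hr).
  (* The exceptional radii 0 and [rho] may be endpoints here but not interior points; an interval
     containing [rho] is then cut there. *)
  assert (S : forall r1 r2, 0 <= r1 < r2 -> r2 < rad -> ~ (r1 < rho < r2) ->
    cint F r1 = cint F r2).
  { intros r1 r2 H1 H2 Hn. apply (const_closure _ rad); auto.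
    intros x y Hx Hy. apply cint_const; [lra|]. intros z Hz. apply Hd; lra. }
  destruct (Req_dec r 0) as [->|]; [reflexivity|].
  destruct (Rlt_le_dec 0 rho), (Rlt_le_dec rho r); try (apply S; lra).
  transitivity (cint F rho); apply S; lra.
Qed.

Lemma slope_ccont f w l z : z <> w -> ccont f z -> ccont (slope f w l) z.
Proof.
  intros Hn Hf. pose proof (proj1 (Cmod_gt_0 _) (Cminus_neq0 _ _ Hn)) as Hp.
  apply (ccont_local (fun u => (f u - f w) / (u - w))%C _ z (Cmod (z - w)) Hp).
  - intros u Hu. unfold slope; destruct (Ceq_dec u w) as [->|]; [|reflexivity].
    rewrite Cmod_minus_sym in Hu; lra.
  - apply ccont_div; [|apply ccont_minus; auto using ccont_id, ccont_const|now apply Cminus_neq0].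
    apply ccont_minus; auto using ccont_const.
Qed.

Lemma ex_cderiv_plus f g z : (exists l, cderiv f z l) -> (exists l, cderiv g z l) ->
  exists l, cderiv (fun w => f w + g w)%C z l.
Proof. intros [l Hl] [m Hm]; eexists; now apply cderiv_plus; eauto. Qed.

Lemma ex_cderiv_mult f g z : (exists l, cderiv f z l) -> (exists l, cderiv g z l) ->
  exists l, cderiv (fun w => f w * g w)%C z l.
Proof. intros [l Hl] [m Hm]; eexists; eapply cderiv_mult; eauto. Qed.

Lemma ex_cderiv_const c z : exists l, cderiv (fun _ => c) z l.
Proof. eexists; apply cderiv_const. Qed.

Lemma ex_cderiv_id z : exists l, cderiv (fun w => w) z l.
Proof. eexists; apply cderiv_id. Qed.

Lemma ex_cderiv_minus f g z : (exists l, cderiv f z l) -> (exists l, cderiv g z l) ->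
  exists l, cderiv (fun w => f w - g w)%C z l.
Proof.
  intros Hf Hg.
  destruct (ex_cderiv_plus f _ z Hf (ex_cderiv_mult _ _ z (ex_cderiv_const (- (1))%C z) Hg)) as [l Hl].
  exists l. refine (cderiv_local _ _ _ _ 1 Rlt_0_1 _ Hl). intros; ring.
Qed.

Lemma ex_cderiv_div f g z : (exists l, cderiv f z l) -> (exists l, cderiv g z l) ->
  g z <> 0%C -> exists l, cderiv (fun w => f w / g w)%C z l.
Proof.
  intros Hf [m Hm] H0. apply ex_cderiv_mult; [exact Hf|].
  eexists; apply (cderiv_inv g z m Hm H0).
Qed.

Lemma ex_cderiv_comp f g z : (exists l, cderiv f (g z) l) -> (exists l, cderiv g z l) ->
  exists l, cderiv (fun w => f (g w)) z l.
Proof. intros [l Hl] [m Hm]; eexists; eapply cderiv_comp; eauto. Qed.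

Lemma slope_ex_cderiv f w l z : z <> w -> (exists m, cderiv f z m) ->
  exists m, cderiv (slope f w l) z m.
Proof.
  intros Hn Hf. pose proof (proj1 (Cmod_gt_0 _) (Cminus_neq0 _ _ Hn)) as Hp.
  destruct (ex_cderiv_div (fun u => f u - f w)%C (fun u => u - w)%C z) as [m Hm].
  - apply ex_cderiv_minus; auto using ex_cderiv_const.
  - apply ex_cderiv_minus; auto using ex_cderiv_const, ex_cderiv_id.
  - now apply Cminus_neq0.
  - exists m. refine (cderiv_local _ _ _ _ _ Hp _ Hm).
    intros u Hu. unfold slope; destruct (Ceq_dec u w) as [->|]; [|reflexivity].
    rewrite Cmod_minus_sym in Hu; lra.
Qed.

Lemma Cmod_neq (z w : C) : Cmod z <> Cmod w -> z <> w.
Proof. congruence. Qed.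

Lemma Cmod_minus_ge z w : Cmod z - Cmod w <= Cmod (z - w).
Proof. pose proof (Cmod_minus_le z w); lra. Qed.

Lemma kernel_ccont w z : z <> w -> ccont (fun z => z / (z - w))%C z.
Proof.
  intros Hn. apply ccont_div; [apply ccont_id| |now apply Cminus_neq0].
  apply ccont_minus; auto using ccont_id, ccont_const.
Qed.

(** The integral does not depend on the radius beyond [Cmod w], and on a large circle the integrand
    differs from 1 by [w / (z - w)], which tends to 0. *)
Lemma cint_kernel w r : Cmod w < r -> cint (fun z => z / (z - w))%C r = RtoC (2 * PI).
Proof.
  intros Hr. pose proof (Cmod_ge_0 w) as Hw. pose proof PI_RGT_0 as Hpi.
  assert (Hc : forall rho t, Cmod w < rho -> ccont (fun z => z / (z - w))%C (RtoC rho * cis t)).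
  { intros rho t Hrho. apply kernel_ccont, Cmod_neq. rewrite Cmod_polar; lra. }
  assert (K : forall rho, r < rho ->
    Cmod (cint (fun z => z / (z - w))%C r - RtoC (2 * PI)) <= 2 * PI * (Cmod w / (rho - Cmod w))).
  { intros rho Hrho. rewrite (cint_const _ r rho); [|lra|].
    2:{ intros z Hz. apply ex_cderiv_div; [apply ex_cderiv_id| |apply Cminus_neq0, Cmod_neq; lra].
        apply ex_cderiv_minus; auto using ex_cderiv_const, ex_cderiv_id. }
    replace (RtoC (2 * PI)) with (cint (fun _ => 1%C) rho).
    2:{ unfold cint. rewrite CInt_const. rewrite Rminus_0_r. ring. }
    rewrite <- cint_minus; [|intros; apply Hc; lra|intros; apply ccont_const].
    apply cint_bound.
    { intros t. apply ccont_minus; [apply Hc; lra|apply ccont_const]. }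
    intros t _. set (z := (RtoC rho * cis t)%C).
    assert (Hz : Cmod z = rho) by (apply Cmod_polar; lra).
    assert (Hzw : z <> w) by (apply Cmod_neq; lra). apply Cminus_neq0 in Hzw.
    replace (z / (z - w) - 1)%C with (w / (z - w))%C by (field; exact Hzw).
    rewrite Cmod_div by exact Hzw. apply Rmult_le_compat_l; [exact Hw|].
    apply Rinv_le_contravar; [lra|]. rewrite <- Hz. apply Cmod_minus_ge. }
  destruct (Ceq_dec (cint (fun z => z / (z - w))%C r) (RtoC (2 * PI))) as [|N]; [assumption|exfalso].
  apply Cminus_neq0, Cmod_gt_0 in N.
  set (m := Cmod (cint (fun z => z / (z - w))%C r - RtoC (2 * PI))) in *.
  assert (P : 0 <= 2 * PI * (Cmod w + 1) / m).
  { apply Rlt_le, Rdiv_lt_0_compat; [nra|exact N]. }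
  (* For this radius, [s = rho - Cmod w] satisfies [m * s > 2 * PI * (Cmod w + 1)], whereas [K]
     gives [m * s <= 2 * PI * Cmod w]. *)
  specialize (K (r + 2 * PI * (Cmod w + 1) / m + Cmod w + 1)).
  set (s := r + 2 * PI * (Cmod w + 1) / m + 1) in *.
  specialize (K ltac:(lra)).
  replace (r + 2 * PI * (Cmod w + 1) / m + Cmod w + 1 - Cmod w) with s in K by (unfold s; ring).
  assert (Hs : 0 < s) by (unfold s; lra).
  apply (Rmult_le_compat_r s) in K; [|lra].
  replace (2 * PI * (Cmod w / s) * s) with (2 * PI * Cmod w) in K by (field; lra).
  assert (m * s = m * (r + 1) + 2 * PI * (Cmod w + 1)) by (unfold s; field; lra).
  assert (0 < m * (r + 1)) by (apply Rmult_lt_0_compat; lra). lra.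
Qed.

(** What is known of a difference quotient based at 0 before removability: continuity on the whole
    disc, differentiability away from the centre. *)
Definition hol0 (rad : R) (f : C -> C) : Prop :=
  (forall z, Cmod z < rad -> ccont f z) /\
  (forall z, 0 < Cmod z < rad -> exists l, cderiv f z l).

(** With respect to the angle, Cauchy's kernel becomes [z / (z - w)]. The mean value property is
    applied to [slope f w l z * z], which vanishes at 0 and fails to be known differentiable only on
    the circle through [w]; this is the one circle that [mean_value] allows. *)
Lemma cauchy_formula rad f r w : hol0 rad f -> Cmod w < r < rad ->
  cint (fun z => f z * (z / (z - w)))%C r = (RtoC (2 * PI) * f w)%C.
Proof.
  intros [Hc Hd] Hr. pose proof (Cmod_ge_0 w) as Hw.
  destruct (Ceq_dec w 0) as [->|Hw0].
  - rewrite <- (mean_value f rad 0 r); [|exact Hc|intros; now apply Hd|lra].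
    apply cint_ext; [|lra]. intros z Hz.
    field. intros E. replace (z - 0)%C with z in E by ring. rewrite E, Cmod_0 in Hz. rewrite Cmod_0 in Hr. lra.
  - pose proof (proj1 (Cmod_gt_0 _) Hw0) as Hwp.
    destruct (Hd w ltac:(lra)) as [l Hl].
    assert (Hkc : forall t, ccont (fun z => z / (z - w))%C (RtoC r * cis t)).
    { intros t. apply kernel_ccont, Cmod_neq. rewrite Cmod_polar; lra. }
    assert (Hfc : forall t, ccont f (RtoC r * cis t)).
    { intros t. apply Hc. rewrite Cmod_polar; lra. }
    assert (M : cint (fun z => slope f w l z * z)%C r = RtoC 0).
    { rewrite (mean_value _ rad (Cmod w) r); [ring| | |lra].
      - intros z Hz. apply ccont_mult; [|apply ccont_id].
        destruct (Ceq_dec z w) as [->|Hn]; [exact Hl|]. apply slope_ccont; auto.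
      - intros z Hz Hn. apply ex_cderiv_mult; [|apply ex_cderiv_id].
        apply slope_ex_cderiv; [congruence|auto]. }
    rewrite (cint_ext _ (fun z => f z * (z / (z - w)) - f w * (z / (z - w)))%C) in M; [| |lra].
    2:{ intros z Hz. unfold slope; destruct (Ceq_dec z w) as [->|Hn]; [lra|].
        field. now apply Cminus_neq0. }
    rewrite cint_minus, cint_scal, cint_kernel in M; [|lra|exact Hkc| |].
    + set (A := cint (fun z => f z * (z / (z - w)))%C r) in *.
      replace A with (A - f w * RtoC (2 * PI) + f w * RtoC (2 * PI))%C by ring.
      rewrite M. ring.
    + intros t; apply ccont_mult; auto.
    + intros t; apply ccont_mult; auto using ccont_const.
Qed.

(** * Removable singularities, the maximum principle and the Schur step *)

Lemma circle_bounded f r : (forall t, ccont f (RtoC r * cis t)) ->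
  exists M, 0 < M /\ forall t, 0 <= t <= 2 * PI -> Cmod (f (RtoC r * cis t)%C) <= M.
Proof.
  intros Hf. pose proof PI_RGT_0.
  destruct (continuity_ab_maj (fun t => Cmod (f (RtoC r * cis t)%C)) 0 (2 * PI)) as [m [Hm _]].
  - lra.
  - intros t _. apply continuity_pt_locally. intros e.
    destruct (pcont_polar f r t (Hf t) e (cond_pos e)) as [d [Hd Hs]].
    exists (mkposreal d Hd). intros s Hst. specialize (Hs s Hst).
    eapply Rle_lt_trans; [|exact Hs].
    apply Rabs_le. split.
    + pose proof (Cmod_minus_le (f (RtoC r * cis t)%C) (f (RtoC r * cis s)%C)) as T.
      rewrite Cmod_minus_sym in T. lra.
    + pose proof (Cmod_minus_le (f (RtoC r * cis s)%C) (f (RtoC r * cis t)%C)) as T. lra.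
  - exists (Cmod (f (RtoC r * cis m)%C) + 1). split.
    + pose proof (Cmod_ge_0 (f (RtoC r * cis m)%C)). lra.
    + intros t Ht. specialize (Hm t Ht). lra.
Qed.

Lemma hol0_circle rad f r t : hol0 rad f -> 0 <= r < rad -> ccont f (RtoC r * cis t).
Proof. intros [Hc _] Hr. apply Hc. rewrite Cmod_polar; lra. Qed.

(** Cauchy's formula supplies the candidate, the mean of [f z / z] over a circle. After subtraction
    of the first-order part the kernel is [w * w / (z * (z - w))], so the error is quadratic in
    [w]. *)
Lemma removable rad f : 0 < rad -> hol0 rad f -> exists l, cderiv f 0 l.
Proof.
  intros HR Hf. pose proof PI_RGT_0 as Hpi. set (r := rad / 2).
  assert (Hr : 0 < r < rad) by (unfold r; lra).
  assert (Hfc : forall t, ccont f (RtoC r * cis t)) by (intros; apply (hol0_circle rad); auto; lra).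
  destruct (circle_bounded f r Hfc) as [M [HM0 HM]].
  set (I := cint (fun z => f z / z)%C r).
  exists (I / RtoC (2 * PI))%C.
  assert (H2pi : RtoC (2 * PI) <> 0%C) by (intros E; apply RtoC_inj in E; lra).
  assert (K : forall w, Cmod w < r / 2 ->
    Cmod (f w - f 0 - I / RtoC (2 * PI) * w) <= 2 * M / (r * r) * (Cmod w * Cmod w)).
  { intros w Hw. pose proof (Cmod_ge_0 w) as Hw0.
    assert (Hkc : forall t, ccont (fun z => z / (z - w))%C (RtoC r * cis t)).
    { intros t. apply kernel_ccont, Cmod_neq. rewrite Cmod_polar; lra. }
    assert (Hic : forall t, ccont (fun z => f z / z)%C (RtoC r * cis t)).
    { intros t. apply ccont_div; [apply Hfc|apply ccont_id|].
      apply Cmod_gt_0. rewrite Cmod_polar; lra. }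
    pose proof (cauchy_formula rad f r w Hf ltac:(lra)) as E1.
    pose proof (mean_value f rad 0 r (proj1 Hf) (fun z Hz _ => proj2 Hf z Hz) ltac:(lra)) as E2.
    assert (Hc1 : forall t, ccont (fun z => f z * (z / (z - w)))%C (RtoC r * cis t))
      by (intros t; apply ccont_mult; auto).
    assert (E : (RtoC (2 * PI) * (f w - f 0 - I / RtoC (2 * PI) * w))%C
      = cint (fun z => f z * (z / (z - w)) - f z - w * (f z / z))%C r).
    { rewrite cint_minus, cint_minus, cint_scal, E1, E2; auto.
      - fold I. field. exact H2pi.
      - intros t; apply ccont_minus; auto.
      - intros t; apply ccont_mult; auto using ccont_const. }
    assert (B : Cmod (RtoC (2 * PI) * (f w - f 0 - I / RtoC (2 * PI) * w))
      <= 2 * PI * (2 * M / (r * r) * (Cmod w * Cmod w))).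
    { rewrite E. apply cint_bound.
      - intros t. repeat apply ccont_minus; auto. apply ccont_mult; auto using ccont_const.
      - intros t Ht. specialize (HM t Ht). set (z := (RtoC r * cis t)%C) in *.
        assert (Hz : Cmod z = r) by (apply Cmod_polar; lra).
        assert (Hz0 : z <> 0%C) by (apply Cmod_gt_0; lra).
        assert (Hzw : (z - w)%C <> 0%C) by (apply Cminus_neq0, Cmod_neq; lra).
        replace (f z * (z / (z - w)) - f z - w * (f z / z))%C
          with (f z * (w * w) / (z * (z - w)))%C by (field; auto).
        rewrite Cmod_div by now apply Cmult_neq_0. rewrite !Cmod_mult, Hz.
        pose proof (Cmod_minus_ge z w). pose proof (Cmod_ge_0 (f z)).
        replace (2 * M / (r * r) * (Cmod w * Cmod w))
          with (M * (Cmod w * Cmod w) * / (r * (r / 2))) by (field; lra).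
        apply Rmult_le_compat; [nra| |nra|].
        + apply Rlt_le, Rinv_0_lt_compat. nra.
        + apply Rinv_le_contravar; nra. }
    rewrite Cmod_mult, Cmod_R, Rabs_pos_eq in B by lra.
    apply Rmult_le_reg_l in B; lra. }
  apply cderiv_eps. intros e He.
  assert (HA : 0 < 2 * M / (r * r)) by (apply Rdiv_lt_0_compat; nra).
  set (A := 2 * M / (r * r)) in *.
  exists (Rmin (r / 2) (e / A)). split.
  { apply Rmin_glb_lt; [lra|]. now apply Rdiv_lt_0_compat. }
  intros w Hw. replace (w - 0)%C with w in * by ring.
  apply Rmin_Rgt in Hw as [G1 G2]. eapply Rle_trans; [apply K; lra|].
  rewrite <- Rmult_assoc. apply Rmult_le_compat_r; [apply Cmod_ge_0|].
  replace e with (A * (e / A)) by (field; lra). apply Rmult_le_compat_l; lra.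
Qed.

(** The difference of two Cauchy kernels is [z * (w - u) / ((z - w) * (z - u))]. This uniform
    estimate later bounds a derivative near 0 without any knowledge of its continuity. *)
Lemma hol0_lipschitz rad f : 0 < rad -> hol0 rad f -> exists A d, 0 < A /\ 0 < d <= rad /\
  forall z w, Cmod z < d -> Cmod w < d -> Cmod (f w - f z) <= A * Cmod (w - z).
Proof.
  intros HR Hf. pose proof PI_RGT_0 as Hpi. set (r := rad / 2).
  assert (Hr : 0 < r < rad) by (unfold r; lra).
  assert (Hfc : forall t, ccont f (RtoC r * cis t)) by (intros; apply (hol0_circle rad); auto; lra).
  destruct (circle_bounded f r Hfc) as [M [HM0 HM]].
  exists (4 * M / r), (r / 2). split; [apply Rdiv_lt_0_compat; lra|]. split; [lra|].
  intros u w Hu Hw. pose proof (Cmod_ge_0 w) as Hw0. pose proof (Cmod_ge_0 u) as Hu0.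
  assert (Hkc : forall v, Cmod v < r -> forall t, ccont (fun z => f z * (z / (z - v)))%C (RtoC r * cis t)).
  { intros v Hv t. apply ccont_mult; [auto|]. pose proof (Cmod_ge_0 v).
    apply kernel_ccont, Cmod_neq. rewrite Cmod_polar; lra. }
  apply (Rmult_le_reg_l (2 * PI)); [lra|].
  rewrite <- (Rabs_pos_eq (2 * PI)) at 1 by lra. rewrite <- Cmod_R, <- Cmod_mult.
  replace (RtoC (2 * PI) * (f w - f u))%C
    with (cint (fun z => f z * (z / (z - w)) - f z * (z / (z - u)))%C r).
  2:{ rewrite cint_minus by (apply Hkc; lra).
      rewrite !(cauchy_formula rad) by (auto; lra). ring. }
  apply cint_bound.
  { intros t. apply ccont_minus; apply Hkc; lra. }
  intros t Ht. specialize (HM t Ht). set (z := (RtoC r * cis t)%C) in *.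
  assert (Hz : Cmod z = r) by (apply Cmod_polar; lra).
  assert (Hzw : (z - w)%C <> 0%C) by (apply Cminus_neq0, Cmod_neq; lra).
  assert (Hzu : (z - u)%C <> 0%C) by (apply Cminus_neq0, Cmod_neq; lra).
  replace (f z * (z / (z - w)) - f z * (z / (z - u)))%C
    with (f z * z * (w - u) / ((z - w) * (z - u)))%C by (field; auto).
  rewrite Cmod_div by now apply Cmult_neq_0. rewrite !Cmod_mult, Hz.
  pose proof (Cmod_minus_ge z w). pose proof (Cmod_minus_ge z u).
  pose proof (Cmod_ge_0 (f z)). pose proof (Cmod_ge_0 (w - u)).
  replace (4 * M / r * Cmod (w - u)) with (M * r * Cmod (w - u) * / ((r / 2) * (r / 2)))
    by (field; lra).
  apply Rmult_le_compat.
  - repeat apply Rmult_le_pos; lra.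
  - apply Rlt_le, Rinv_0_lt_compat. nra.
  - apply Rmult_le_compat_r; [lra|]. apply Rmult_le_compat_r; lra.
  - apply Rinv_le_contravar; nra.
Qed.

Lemma hol0_pow rad f n : hol0 rad f -> hol0 rad (fun z => f z ^ n)%C.
Proof.
  intros [Hc Hd]; split; intros z Hz; induction n as [|n IH]; simpl.
  - apply ccont_const.
  - apply ccont_mult; auto.
  - apply ex_cderiv_const.
  - apply ex_cderiv_mult; auto.
Qed.

(** By Bernoulli's inequality the powers of a ratio [x / M > 1] exceed every constant [K]. *)
Lemma pow_bound_le x M K : 0 < M -> (forall n, x ^ n <= K * M ^ n) -> 0 <= x -> x <= M.
Proof.
  intros HM H Hx. apply Rnot_lt_le; intros L.
  set (h := x / M - 1).
  assert (Hh : 0 < h).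
  { unfold h. apply (Rmult_lt_reg_r M); [exact HM|]. field_simplify; lra. }
  destruct (INR_unbounded (K / h)) as [n Hn].
  pose proof (poly n h Hh) as P. replace (1 + h) with (x / M) in P by (unfold h; ring).
  assert (E : (x / M) ^ n <= K).
  { apply (Rmult_le_reg_r (M ^ n)); [now apply pow_lt|].
    rewrite <- Rpow_mult_distr. replace (x / M * M) with x by (field; lra). apply H. }
  apply (Rmult_lt_compat_r h) in Hn; [|exact Hh].
  replace (K / h * h) with K in Hn by (field; lra). lra.
Qed.

(* Landau's trick: the crude Cauchy bound for all powers of f sharpens to constant 1. *)
Lemma max_principle rad f r M w : hol0 rad f -> Cmod w < r < rad -> 0 < M ->
  (forall z, Cmod z = r -> Cmod (f z) <= M) -> Cmod (f w) <= M.
Proof.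
  intros Hf Hr HM HB. pose proof PI_RGT_0 as Hpi. pose proof (Cmod_ge_0 w) as Hw.
  apply (pow_bound_le _ _ (r / (r - Cmod w)) HM); [|apply Cmod_ge_0]. intros n.
  apply (Rmult_le_reg_l (2 * PI)); [lra|].
  rewrite <- Cmod_pow.
  rewrite <- (Rabs_pos_eq (2 * PI)) at 1 by lra. rewrite <- Cmod_R, <- Cmod_mult.
  rewrite <- (cauchy_formula rad (fun z => f z ^ n)%C r w (hol0_pow rad f n Hf) Hr).
  apply cint_bound.
  - intros t. apply ccont_mult.
    + apply (hol0_circle rad (fun z => f z ^ n)%C); [now apply hol0_pow|lra].
    + apply kernel_ccont, Cmod_neq. rewrite Cmod_polar; lra.
  - intros t _. set (z := (RtoC r * cis t)%C).
    assert (Hz : Cmod z = r) by (apply Cmod_polar; lra).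
    assert (Hzw : (z - w)%C <> 0%C) by (apply Cminus_neq0, Cmod_neq; lra).
    rewrite Cmod_mult, Cmod_pow, Cmod_div, Hz by exact Hzw. rewrite Rmult_comm.
    apply Rmult_le_compat.
    + apply Rlt_le, Rdiv_lt_0_compat; [lra|]. now apply Cmod_gt_0.
    + apply pow_le, Cmod_ge_0.
    + apply Rmult_le_compat_l; [lra|]. apply Rinv_le_contravar; [lra|].
      rewrite <- Hz. apply Cmod_minus_ge.
    + apply pow_incr. split; [apply Cmod_ge_0|now apply HB].
Qed.

(** * The Schur class and the Schur step *)

Definition holo (rad : R) (f : C -> C) : Prop :=
  forall z, Cmod z < rad -> exists l, cderiv f z l.

Lemma holo_hol0 rad f : holo rad f -> hol0 rad f.
Proof.
  intros H; split; intros z Hz; [|apply H; lra].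
  destruct (H z Hz) as [l Hl]. eapply cderiv_ccont, Hl.
Qed.

(** Removability at the base point is what allows difference quotients, and hence Schur steps, to be
    iterated. *)
Lemma holo_slope rad f l : 0 < rad -> holo rad f -> cderiv f 0 l -> holo rad (slope f 0 l).
Proof.
  intros HR Hf Hl.
  assert (H0 : hol0 rad (slope f 0 l)).
  { split; intros z Hz.
    - destruct (Ceq_dec z 0) as [->|Hn]; [exact Hl|].
      apply slope_ccont; [exact Hn|]. now apply (holo_hol0 rad).
    - apply slope_ex_cderiv; [|apply Hf; lra]. apply Cmod_neq. rewrite Cmod_0; lra. }
  intros z Hz. destruct (Ceq_dec z 0) as [->|Hn].
  - now apply (removable rad).
  - apply (proj2 H0). apply Cmod_gt_0 in Hn; lra.
Qed.

(* The bound is not strict, so that the constants 1 and -1, at which the Schur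
   algorithm stops, are included. *)
Definition schur (f : C -> C) : Prop :=
  holo 1 f /\ (forall z, Cmod z < 1 -> Cmod (f z) <= 1) /\
  (forall x : R, Rabs x < 1 -> Im (f x) = 0).

Lemma Im_ccont_0 f : ccont f 0 -> (forall x : R, 0 < Rabs x < 1 -> Im (f x) = 0) -> Im (f 0) = 0.
Proof.
  intros Hc H. destruct (Req_dec (Im (f 0)) 0) as [|N]; [assumption|exfalso].
  apply Rabs_pos_lt in N. destruct (Hc _ N) as [d [Hd Hs]].
  pose proof (Rmin_glb_lt d 1 0 Hd Rlt_0_1) as Hp.
  pose proof (Rmin_l d 1); pose proof (Rmin_r d 1).
  set (x := Rmin d 1 / 2) in *.
  assert (Hx : Rabs x = x) by (apply Rabs_pos_eq; unfold x; lra).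
  specialize (Hs x). replace (RtoC x - 0)%C with (RtoC x) in Hs by ring. rewrite Cmod_R, Hx in Hs.
  specialize (Hs ltac:(unfold x; lra)). specialize (H x ltac:(rewrite Hx; unfold x; lra)).
  pose proof (Rabs_snd_le (f x - f 0)) as T.
  replace (snd (f x - f 0)%C) with (Im (f x) - Im (f 0)) in T by reflexivity.
  rewrite H, Rminus_0_l, Rabs_Ropp in T. lra.
Qed.

(** The squares of the two sides differ by [(1 - a^2) (1 - |z|^2)]. *)
Lemma Cmod_moebius_le (a : R) z : Rabs a < 1 -> Cmod z <= 1 ->
  Cmod (z - RtoC a) <= Cmod (1 - RtoC a * z).
Proof.
  intros Ha Hz. destruct z as [x y].
  assert (Hz2 : x ^ 2 + y ^ 2 <= 1).
  { unfold Cmod in Hz; simpl fst in Hz; simpl snd in Hz.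
    rewrite <- sqrt_1 in Hz. apply sqrt_le_0 in Hz; nra. }
  apply Rabs_def2 in Ha. unfold Cmod. apply sqrt_le_1_alt.
  unfold Cminus, Cplus, Copp, Cmult, RtoC; simpl.
  assert (0 <= (1 - a * a) * (1 - (x ^ 2 + y ^ 2))) by (apply Rmult_le_pos; nra).
  lra.
Qed.

(** This is Schwarz's lemma for [g], the Möbius transform of [f] that vanishes at 0, with
    [f1 = g(w) / w]. The relation is kept free of division, the form in which it is used for
    elimination later. *)
Lemma schur_step f a : schur f -> f 0 = RtoC a -> Rabs a < 1 ->
  exists f1, schur f1 /\
    forall w, Cmod w < 1 -> (f w - RtoC a = w * f1 w * (1 - RtoC a * f w))%C.
Proof.
  intros [Hh [Hb Hr]] H0 Ha.
  assert (Hden : forall z, Cmod z < 1 -> (1 - RtoC a * f z)%C <> 0%C).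
  { intros z Hz E. specialize (Hb z Hz).
    assert (E1 : (RtoC a * f z)%C = 1%C) by (replace (RtoC a * f z)%C with (1 - (1 - RtoC a * f z))%C by ring; rewrite E; ring).
    apply (f_equal Cmod) in E1. rewrite Cmod_mult, Cmod_R, Cmod_1 in E1.
    pose proof (Cmod_ge_0 (f z)); pose proof (Rabs_pos a). nra. }
  set (g := fun z => ((f z - RtoC a) / (1 - RtoC a * f z))%C).
  assert (Hg : holo 1 g).
  { intros z Hz. unfold g. apply ex_cderiv_div; [| |now apply Hden].
    - apply ex_cderiv_minus; auto using ex_cderiv_const.
    - apply ex_cderiv_minus; auto using ex_cderiv_const.
      apply ex_cderiv_mult; auto using ex_cderiv_const. }
  assert (Hg1 : forall z, Cmod z < 1 -> Cmod (g z) <= 1).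
  { intros z Hz. unfold g. rewrite Cmod_div by now apply Hden.
    pose proof (proj1 (Cmod_gt_0 _) (Hden z Hz)).
    apply (Rmult_le_reg_r (Cmod (1 - RtoC a * f z))); [assumption|].
    unfold Rdiv. rewrite Rmult_assoc, Rinv_l, Rmult_1_r, Rmult_1_l by lra.
    now apply Cmod_moebius_le; auto. }
  assert (C0 : Cmod 0 < 1) by (rewrite Cmod_0; lra).
  assert (Hg0 : g 0 = 0%C) by (unfold g; rewrite H0; unfold Cdiv; ring).
  destruct (Hg 0 C0) as [l Hl].
  assert (Hs := holo_slope 1 g l Rlt_0_1 Hg Hl).
  assert (Hmul : forall z, g z = (slope g 0 l z * z)%C).
  { intros z. replace (g z) with (g z - g 0)%C by (rewrite Hg0; ring).
    rewrite (slope_mul g 0 l). f_equal. ring. }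
  exists (slope g 0 l). split; [split; [exact Hs|split]|].
  - intros w Hw. pose proof (Cmod_ge_0 w) as Hw0.
    apply Rnot_lt_le. intros L. set (m := Cmod (slope g 0 l w)) in *.
    (* A radius below 1 that encloses [w] and satisfies [/ r < m]; on its circle the quotient is at
       most [/ r]. *)
    set (r := (1 + Rmax (Cmod w) (/ m)) / 2).
    assert (Hm : / m < 1) by (rewrite <- Rinv_1; apply Rinv_lt_contravar; lra).
    assert (Hm0 : 0 < / m) by (apply Rinv_0_lt_compat; lra).
    assert (Hr1 : Rmax (Cmod w) (/ m) < 1) by (apply Rmax_lub_lt; lra).
    pose proof (Rmax_l (Cmod w) (/ m)); pose proof (Rmax_r (Cmod w) (/ m)).
    assert (B : m <= / r).
    { apply (max_principle 1 _ r _ _ (holo_hol0 _ _ Hs)); [unfold r; lra| |].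
      - apply Rinv_0_lt_compat. unfold r; lra.
      - intros z Hz. specialize (Hg1 z). rewrite Hmul, Cmod_mult, Hz in Hg1.
        specialize (Hg1 ltac:(unfold r; lra)).
        apply (Rmult_le_reg_r r); [unfold r; lra|]. rewrite Rinv_l by (unfold r; lra). exact Hg1. }
    assert (Hr2 : / m < r) by (unfold r; lra).
    apply (Rinv_lt_contravar (/ m) r) in Hr2; [|nra]. rewrite Rinv_inv in Hr2. lra.
  - assert (Hne : forall x : R, 0 < Rabs x < 1 -> Im (slope g 0 l x) = 0).
    { intros x Hx. assert (Hx0 : RtoC x <> 0%C).
      { apply Cmod_gt_0. rewrite Cmod_R; lra. }
      unfold slope. destruct (Ceq_dec x 0) as [E|_]; [contradiction|].
      rewrite Hg0. unfold g.
      specialize (Hr x ltac:(lra)). specialize (Hden x ltac:(rewrite Cmod_R; lra)).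
      assert (E : f x = RtoC (Re (f x))).
      { destruct (f x) as [u v]. simpl in Hr. unfold RtoC; simpl. now rewrite Hr. }
      rewrite E in *. set (y := Re (f x)) in *.
      replace ((RtoC y - RtoC a) / (1 - RtoC a * RtoC y) - 0)%C
        with (RtoC ((y - a) / (1 - a * y))).
      2:{ rewrite RtoC_div, !RtoC_minus, RtoC_mult. ring.
        intros E1; apply Hden. rewrite <- RtoC_mult, <- RtoC_minus, E1. reflexivity. }
      replace (RtoC x - 0)%C with (RtoC x) by ring.
      rewrite <- RtoC_div by (intros E1; apply Hx0; now rewrite E1). reflexivity. }
    intros x Hx. destruct (Req_dec x 0) as [->|N].
    + apply Im_ccont_0; [|exact Hne]. now apply (holo_hol0 1).
    + apply Hne. split; [now apply Rabs_pos_lt|exact Hx].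
  - intros w Hw. rewrite (Cmult_comm w), <- Hmul. unfold g. field. now apply Hden.
Qed.

(** * From the strip to the disc *)

Lemma schur_real f (x : R) : schur f -> Rabs x < 1 -> f x = RtoC (Re (f x)).
Proof.
  intros [_ [_ Hr]] Hx. specialize (Hr x Hx).
  destruct (f x) as [u v]; simpl in *. unfold RtoC. now rewrite Hr.
Qed.

Lemma schur_Re_le f (x : R) : schur f -> Rabs x < 1 -> Rabs (Re (f x)) <= 1.
Proof.
  intros Hf Hx. eapply Rle_trans; [apply re_le_Cmod|]. apply Hf. now rewrite Cmod_R.
Qed.

(* Apply the Schur step to c f with c < 1 and let c tend to 1. *)
Lemma schur_const f a : schur f -> f 0 = RtoC a -> Rabs a = 1 ->
  forall w, Cmod w < 1 -> f w = RtoC a.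
Proof.
  intros Hf H0 Ha w Hw.
  destruct (Ceq_dec (f w) (RtoC a)) as [|N]; [assumption|exfalso].
  apply Cminus_neq0, Cmod_gt_0 in N. set (d := Cmod (f w - RtoC a)) in *.
  pose proof (Cmod_ge_0 w) as Hw0.
  assert (Ha2 : a * a = 1) by (unfold Rabs in Ha; destruct (Rcase_abs a); nra).
  (* In the limit [c -> 1] this becomes [d <= Cmod w * d], impossible for [d > 0] and [Cmod w < 1].
     The factor [c] makes the value at 0 smaller than 1 in modulus, as the Schur step requires. *)
  assert (K : forall c, 0 < c < 1 -> c * d <= Cmod w * (d + (1 - c * c))).
  { intros c Hc. destruct Hf as [Hh [Hb Hr]].
    assert (Hcf : schur (fun z => RtoC c * f z)%C).
    { split; [|split].
      - intros z Hz. apply ex_cderiv_mult; auto using ex_cderiv_const.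
      - intros z Hz. rewrite Cmod_mult, Cmod_R, Rabs_pos_eq by lra.
        specialize (Hb z Hz). pose proof (Cmod_ge_0 (f z)). nra.
      - intros x Hx. specialize (Hr x Hx). destruct (f x) as [u v]; simpl in *. rewrite Hr; ring. }
    destruct (schur_step _ (c * a) Hcf) as [f1 [[_ [Hb1 _]] E]].
    { rewrite H0, RtoC_mult. reflexivity. }
    { rewrite Rabs_mult, Ha, Rabs_pos_eq; lra. }
    specialize (E w Hw); simpl in E. specialize (Hb1 w Hw).
    assert (E1 : Cmod (RtoC c * f w - RtoC (c * a)) = c * d).
    { replace (RtoC c * f w - RtoC (c * a))%C with (RtoC c * (f w - RtoC a))%C
        by (rewrite RtoC_mult; ring).
      rewrite Cmod_mult, Cmod_R, Rabs_pos_eq by lra. reflexivity. }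
    assert (E2 : Cmod (1 - RtoC (c * a) * (RtoC c * f w)) <= d + (1 - c * c)).
    { replace (1 - RtoC (c * a) * (RtoC c * f w))%C
        with (RtoC (c * c) * (RtoC a * (RtoC a - f w)) + RtoC (1 - c * c))%C.
      2:{ rewrite RtoC_minus, !RtoC_mult.
          replace (RtoC c * RtoC c * (RtoC a * (RtoC a - f w)) + (1 - RtoC c * RtoC c))%C
            with (RtoC c * RtoC c * (RtoC (a * a) - RtoC a * f w) + (1 - RtoC c * RtoC c))%C
            by (rewrite RtoC_mult; ring).
          rewrite Ha2. ring. }
      eapply Rle_trans; [apply Cmod_triangle|].
      rewrite !Cmod_mult, !Cmod_R, Ha, (Cmod_minus_sym (RtoC a)). fold d.
      assert (0 < c * c < 1) by nra.
      rewrite !Rabs_pos_eq by lra.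
      assert (0 <= (1 - c * c) * d) by (apply Rmult_le_pos; lra). lra. }
    rewrite <- E1, E, !Cmod_mult, Rmult_assoc. apply Rmult_le_compat_l; [exact Hw0|].
    eapply Rle_trans; [apply Rmult_le_compat_r; [apply Cmod_ge_0|exact Hb1]|]. lra. }
  set (m := Cmod w) in *.
  (* With [c = 1 - e / 2], the bound [K] yields [(1 - m) * d <= e * (1 + d / 2)], while this [e]
     makes the right side at most a quarter of the left. *)
  set (e := Rmin 1 ((1 - m) * d / (2 * (2 + d)))).
  assert (He0 : 0 < e) by (apply Rmin_glb_lt; [lra|]; apply Rdiv_lt_0_compat; nra).
  assert (He1 : e * (2 + d) <= (1 - m) * d / 2).
  { replace ((1 - m) * d / 2) with ((1 - m) * d / (2 * (2 + d)) * (2 + d)) by (field; lra).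
    apply Rmult_le_compat_r; [lra|apply Rmin_r]. }
  assert (He2 : e <= 1) by apply Rmin_l.
  set (c := 1 - e / 2). specialize (K c ltac:(unfold c; lra)).
  assert (m * (1 - c * c) <= e).
  { unfold c. nra. }
  unfold c in K, H. nra.
Qed.

(** The principal logarithm on the right half-plane, where the arctangent gives the argument. *)
Definition Clog (z : C) : C := (ln (Cmod z), atan (snd z / fst z)).

Lemma cexp_Clog z : 0 < Re z -> cexp (Clog z) = z.
Proof.
  destruct z as [x y]; simpl; intros Hx.
  assert (Hm : 0 < Cmod (x, y)).
  { apply Cmod_gt_0. intros E. injection E; lra. }
  unfold cexp, Clog, cis; simpl. rewrite exp_ln by exact Hm.
  rewrite cos_atan, sin_atan.
  assert (E : sqrt (1 + (y / x)²) = Cmod (x, y) / x).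
  { unfold Cmod; simpl.
    replace (x * (x * 1) + y * (y * 1)) with (x ^ 2 * (1 + (y / x)²)) by (unfold Rsqr; field; lra).
    rewrite sqrt_mult by (try apply pow2_ge_0; pose proof (Rle_0_sqr (y / x)); lra).
    rewrite sqrt_pow2 by lra. field; lra. }
  rewrite E. unfold RtoC, Cmult; simpl. f_equal; field; lra.
Qed.

Lemma Clog_ccont z : 0 < Re z -> ccont Clog z.
Proof.
  destruct z as [x y]; simpl; intros Hx e He.
  assert (Hm : 0 < Cmod (x, y)) by (apply Cmod_gt_0; intros E; injection E; lra).
  destruct (proj1 (continuity_pt_locally ln (Cmod (x, y)))
    (derivable_continuous_pt _ _ (exist _ _ (derivable_pt_lim_ln _ Hm))) (mkposreal (e / 2) ltac:(lra))) as [d1 H1].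
  assert (H : continuity_2d_pt (fun u v => atan (v * / u)) x y).
  { apply continuity_1d_2d_pt_comp.
    - apply derivable_continuous_pt, derivable_pt_atan.
    - apply continuity_2d_pt_mult; [apply continuity_2d_pt_id2|].
      apply continuity_2d_pt_inv; [apply continuity_2d_pt_id1|lra]. }
  destruct (H (mkposreal (e / 2) ltac:(lra))) as [d2 H2]; simpl in H1, H2.
  exists (Rmin d1 d2); split; [apply Rmin_glb_lt; apply cond_pos|].
  intros [u v] Hw. apply Rmin_Rgt in Hw as [G1 G2].
  pose proof (Rabs_fst_le ((u, v) - (x, y))) as F1; pose proof (Rabs_snd_le ((u, v) - (x, y))) as F2.
  simpl in F1, F2.
  specialize (H2 u v ltac:(unfold Rminus; lra) ltac:(unfold Rminus; lra)).
  assert (T : Rabs (Cmod (u, v) - Cmod (x, y)) < d1).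
  { eapply Rle_lt_trans; [|exact G1]. apply Rabs_le.
    pose proof (Cmod_minus_ge (u, v) (x, y)). pose proof (Cmod_minus_ge (x, y) (u, v)) as T2.
    rewrite Cmod_minus_sym in T2. lra. }
  specialize (H1 _ T).
  eapply Rle_lt_trans; [apply Cmod_le_add|]. simpl. unfold Rdiv. lra.
Qed.

(** Differentiation of an inverse function: the difference quotient of [cexp] taken along [Clog] is
    continuous with value [z] at [z], hence nonzero nearby, and its reciprocal is the difference
    quotient of [Clog]. *)
Lemma Clog_ex_cderiv z : 0 < Re z -> exists l, cderiv Clog z l.
Proof.
  intros Hz. assert (Hz0 : z <> 0%C) by (intros E; rewrite E in Hz; simpl in Hz; lra).
  set (S := fun w => slope cexp (Clog z) z (Clog w)).
  assert (HS : ccont S z).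
  { apply (ccont_comp (slope cexp (Clog z) z) Clog); [now apply Clog_ccont|].
    pose proof (cderiv_cexp (Clog z)) as D. rewrite cexp_Clog in D by exact Hz. exact D. }
  assert (S0 : S z = z) by apply slope_same.
  destruct (ccont_neq0 S z HS ltac:(now rewrite S0)) as [r [Hr Hn]].
  exists (/ S z)%C. apply (cderiv_caratheodory _ (fun w => / S w)%C z (Rmin r (Re z))).
  - now apply Rmin_glb_lt.
  - apply ccont_inv; [exact HS|now rewrite S0].
  - intros w Hw. apply Rmin_Rgt in Hw as [G1 G2].
    assert (Hw0 : 0 < Re w).
    { pose proof (Rabs_fst_le (w - z)) as T. destruct w as [u v], z as [x y]; simpl in *.
      assert (T2 : Rabs (u + - x) < x) by lra. apply Rabs_def2 in T2. lra. }
    assert (HSw : S w <> 0%C).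
    { apply Cmod_gt_0. specialize (Hn w G1). pose proof (Cmod_ge_0 (S z)). lra. }
    replace (w - z)%C with (cexp (Clog w) - cexp (Clog z))%C by now rewrite !cexp_Clog.
    rewrite (slope_mul cexp (Clog z) z). fold (S w). field. exact HSw.
Qed.

Definition cayley (w : C) : C := ((1 + w) / (1 - w))%C.

Lemma cayley_den w : Cmod w < 1 -> (1 - w)%C <> 0%C.
Proof.
  intros Hw E. assert (w = 1%C) as E1 by (replace w with (1 - (1 - w))%C by ring; rewrite E; ring).
  rewrite E1, Cmod_1 in Hw; lra.
Qed.

Lemma cayley_Re w : Cmod w < 1 -> 0 < Re (cayley w).
Proof.
  intros Hw. pose proof (cayley_den w Hw) as Hd.
  destruct w as [x y].
  assert (H1 : x ^ 2 + y ^ 2 < 1).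
  { unfold Cmod in Hw; simpl fst in Hw; simpl snd in Hw.
    rewrite <- sqrt_1 in Hw. apply sqrt_lt_0_alt in Hw. exact Hw. }
  unfold cayley, Cdiv, Cinv, Cmult, Cplus, Cminus, Copp, RtoC, Re; simpl.
  match goal with |- 0 < ?e => replace e with ((1 - (x ^ 2 + y ^ 2)) / ((1 - x) ^ 2 + y ^ 2)) end.
  - apply Rdiv_lt_0_compat; [lra|]. nra.
  - assert (x < 1) by nra. field. intros E. nra.
Qed.

Lemma disc_transfer theta : A_1_pi theta ->
  exists f, schur f /\ Cmod (f 0) < 1 /\
    forall x : R, Rabs x < 1 -> f x = theta (RtoC (2 * ln ((1 + x) / (1 - x)))).
Proof.
  intros [Hd [Hr Hb]]. pose proof PI_RGT_0.
  set (psi := fun w => (2 * Clog (cayley w))%C).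
  (* The arctangent stays within [PI / 2], and the factor 2 in [psi] widens this to the strip of
     half-width [PI]. *)
  assert (Hs : forall w, Cmod w < 1 -> strip (psi w)).
  { intros w Hw. unfold strip, psi, Clog. generalize (cayley w); intros u. simpl.
    pose proof (atan_bound (snd u / fst u)) as [B1 B2].
    apply Rabs_def1; lra. }
  assert (Hx : forall x : R, Rabs x < 1 -> psi x = RtoC (2 * ln ((1 + x) / (1 - x)))).
  { intros x Hx. apply Rabs_def2 in Hx. unfold psi, cayley.
    rewrite <- RtoC_plus, <- RtoC_minus, <- RtoC_div by lra.
    assert (0 < (1 + x) / (1 - x)) by (apply Rdiv_lt_0_compat; lra).
    unfold Clog. rewrite Cmod_R, Rabs_pos_eq by lra. simpl.
    unfold Rdiv at 2. rewrite Rmult_0_l, atan_0.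
    unfold RtoC, Cmult; simpl. f_equal; ring. }
  exists (fun w => theta (psi w)). split; [split; [|split]|split].
  - intros w Hw. apply ex_cderiv_comp.
    + destruct (Hd (psi w) (Hs w Hw)) as [l Hl]. exists l. now apply cderiv_is_derive.
    + apply ex_cderiv_mult; [apply ex_cderiv_const|]. apply ex_cderiv_comp.
      * now apply Clog_ex_cderiv, cayley_Re.
      * apply ex_cderiv_div; [apply ex_cderiv_plus|apply ex_cderiv_minus|now apply cayley_den];
          auto using ex_cderiv_const, ex_cderiv_id.
  - intros w Hw. apply Rlt_le, Hb, Hs, Hw.
  - intros x H1. rewrite Hx by exact H1. apply Hr.
  - apply Hb, Hs. rewrite Cmod_0; lra.
  - intros x H1. now rewrite Hx.
Qed.

(** * Second-order Taylor expansions *)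

Lemma cderiv_C_derive f z l : cderiv f z l -> C_derive f z = l.
Proof. intros H. apply is_C_derive_unique. now apply cderiv_is_derive. Qed.

Lemma cderiv_le_lipschitz f z l A r : 0 < r -> cderiv f z l ->
  (forall w, Cmod (w - z) < r -> Cmod (f w - f z) <= A * Cmod (w - z)) -> Cmod l <= A.
Proof.
  intros Hr Hl HA. apply Rnot_lt_le; intros L.
  destruct (Hl (Cmod l - A)) as [d [Hd Hs]]; [lra|].
  pose proof (Rmin_glb_lt d r 0 Hd Hr). pose proof (Rmin_l d r); pose proof (Rmin_r d r).
  set (h := Rmin d r / 2). set (w := (z + RtoC h)%C).
  assert (Hw : Cmod (w - z) = h).
  { unfold w. replace (z + RtoC h - z)%C with (RtoC h) by ring.
    rewrite Cmod_R. apply Rabs_pos_eq. unfold h; lra. }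
  specialize (Hs w ltac:(rewrite Hw; unfold h; lra)). rewrite slope_same in Hs.
  specialize (HA w ltac:(rewrite Hw; unfold h; lra)).
  rewrite (slope_mul f z l), Cmod_mult, Hw in HA.
  apply Rmult_le_reg_r in HA; [|unfold h; lra].
  rewrite Cmod_minus_sym in Hs. pose proof (Cmod_minus_le l (slope f z l w)). lra.
Qed.

(** [p] is the difference quotient at 0 taken twice, so the expansion is an identity. The second
    derivative is defined through [C_derive f] at points near 0, where it equals
    [f'(0) + 2 z p(z) + z^2 p'(z)]. *)
Lemma taylor_order_2 rad f : 0 < rad -> holo rad f ->
  exists p, ccont p 0 /\
    (forall z, f z = f 0 + C_derive f 0 * z + z * z * p z)%C /\
    C_derive (C_derive f) 0 = (2 * p 0)%C.
Proof.
  intros HR Hf. assert (Z0 : Cmod 0 < rad) by (rewrite Cmod_0; exact HR).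
  destruct (Hf _ Z0) as [l Hl]. pose proof (holo_slope rad f l HR Hf Hl) as Hq.
  set (q := slope f 0 l) in *. destruct (Hq _ Z0) as [m Hm].
  pose proof (holo_slope rad q m HR Hq Hm) as Hp. set (p := slope q 0 m) in *.
  assert (Hpc : ccont p 0) by (destruct (Hp _ Z0) as [? D]; eapply cderiv_ccont, D).
  rewrite (cderiv_C_derive _ _ _ Hl).
  assert (E : forall z, (f z = f 0 + l * z + z * z * p z)%C).
  { intros z. pose proof (slope_mul f 0 l z) as E1; fold q in E1.
    pose proof (slope_mul q 0 m z) as E2; fold p in E2.
    unfold q at 2 in E2; rewrite slope_same in E2.
    replace (f z) with (f 0 + (f z - f 0))%C by ring. rewrite E1.
    replace (q z) with (l + (q z - l))%C by ring. rewrite E2. ring. }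
  exists p. split; [exact Hpc|]. split; [exact E|].
  (* A Lipschitz constant of [p] bounds [p'] near 0, so that [z^2 p'(z)] does not contribute to the
     derivative at 0. *)
  destruct (hol0_lipschitz rad p HR (holo_hol0 _ _ Hp)) as [A [d [HA [Hd HL]]]].
  assert (D : forall z, Cmod z < d -> exists k, Cmod k <= A /\
    C_derive f z = (l + (2 * z * p z + z * z * k))%C).
  { intros z Hz. destruct (Hp z ltac:(lra)) as [k Hk]. exists k. split.
    - apply (cderiv_le_lipschitz p z k A (d - Cmod z)); [lra|exact Hk|].
      intros w Hw. apply HL; [exact Hz|]. pose proof (Cmod_minus_le w z). lra.
    - apply cderiv_C_derive.
      pose proof (cderiv_mult _ _ z _ _ (cderiv_mult _ _ z _ _ (cderiv_id z) (cderiv_id z)) Hk) as D1.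
      pose proof (cderiv_mult _ _ z _ _ (cderiv_const l z) (cderiv_id z)) as D2.
      pose proof (cderiv_plus _ _ z _ _ (cderiv_plus _ _ z _ _ (cderiv_const (f 0) z) D2) D1) as D3.
      cbv beta in D3.
      match type of D3 with cderiv _ _ ?v =>
        replace (l + (2 * z * p z + z * z * k))%C with v by ring end.
      refine (cderiv_local _ _ _ _ 1 Rlt_0_1 _ D3). intros w _. now rewrite (E w). }
  apply cderiv_C_derive, cderiv_eps. intros e He.
  destruct (Hpc (e / 4)) as [d1 [Hd1 H1]]; [lra|].
  set (r := Rmin (Rmin d d1) (e / (2 * A))).
  assert (Hr : 0 < r).
  { repeat apply Rmin_glb_lt; try lra. apply Rdiv_lt_0_compat; lra. }
  exists r; split; [exact Hr|]. intros w Hw.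
  assert (Gw : Cmod (w - 0) = Cmod w) by (f_equal; ring).
  rewrite Gw in Hw. apply Rmin_Rgt in Hw as [G1 G3]. apply Rmin_Rgt in G1 as [G1 G2].
  destruct (D w G1) as [k [Hk ->]]. rewrite (cderiv_C_derive _ _ _ Hl).
  replace (l + (2 * w * p w + w * w * k) - l - 2 * p 0 * (w - 0))%C
    with (w * (2 * (p w - p 0) + w * k))%C by ring.
  rewrite Gw, Cmod_mult, (Rmult_comm e). apply Rmult_le_compat_l; [apply Cmod_ge_0|].
  eapply Rle_trans; [apply Cmod_triangle|]. rewrite !Cmod_mult.
  specialize (H1 w ltac:(rewrite Gw; lra)).
  replace (Cmod 2) with 2 by (rewrite Cmod_R, Rabs_pos_eq; lra).
  assert (Cmod w * Cmod k <= e / (2 * A) * A).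
  { apply Rmult_le_compat; try apply Cmod_ge_0; lra. }
  replace (e / (2 * A) * A) with (e / 2) in H by (field; lra). lra.
Qed.

Lemma A_1_pi_taylor theta : A_1_pi theta ->
  exists P : R -> R, continuity_pt P 0 /\ P 0 = taylor theta 2 / 2 /\
    forall x : R, theta x = RtoC (taylor theta 0 + taylor theta 1 * x + x * x * P x).
Proof.
  intros [Hd [Hr _]]. pose proof PI_RGT_0.
  destruct (taylor_order_2 PI theta) as [p [Hp [E D2]]]; [exact PI_RGT_0| |].
  { intros z Hz. destruct (Hd z) as [l Hl].
    - unfold strip. eapply Rle_lt_trans; [apply Rabs_snd_le|exact Hz].
    - exists l. now apply cderiv_is_derive. }
  exists (fun x : R => Re (p x)). split; [|split].
  - apply continuity_pt_locally. intros e. destruct (Hp e (cond_pos e)) as [d [Hd1 Hs]].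
    exists (mkposreal d Hd1). intros x Hx.
    specialize (Hs x). replace (RtoC x - 0)%C with (RtoC (x - 0)) in Hs by (rewrite RtoC_minus; ring).
    rewrite Cmod_R in Hs. eapply Rle_lt_trans; [|apply Hs, Hx].
    exact (Rabs_fst_le (p x - p 0)%C).
  - change (taylor theta 2) with (Re (C_derive (C_derive theta) 0)). rewrite D2. destruct (p 0) as [u v]. simpl. field.
  - intros x. assert (E1 : theta x = RtoC (Re (theta x))).
    { specialize (Hr x). destruct (theta x) as [u v]; simpl in *. unfold RtoC. now rewrite Hr. }
    rewrite E1. f_equal. rewrite (E x).
    change (taylor theta 0) with (Re (theta 0)).
    change (taylor theta 1) with (Re (C_derive theta 0)).
    destruct (theta 0) as [a b], (C_derive theta 0) as [c d], (p x) as [u v]; simpl. ring.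
Qed.

(** * Schur coefficients of theta *)

Lemma schur_Re_continuous f x : schur f -> Rabs x < 1 ->
  continuity_pt (fun t : R => Re (f t)) x.
Proof.
  intros [Hh _] Hx. destruct (Hh x) as [l Hl]; [now rewrite Cmod_R|].
  apply cderiv_ccont in Hl. apply continuity_pt_locally. intros e.
  destruct (Hl e (cond_pos e)) as [d [Hd Hs]]. exists (mkposreal d Hd). intros t Ht.
  eapply Rle_lt_trans; [exact (Rabs_fst_le (f t - f x)%C)|]. apply Hs.
  rewrite <- RtoC_minus, Cmod_R. exact Ht.
Qed.

Lemma schur_step_real f a : schur f -> f 0 = RtoC a -> Rabs a < 1 ->
  exists f1, schur f1 /\ forall x : R, Rabs x < 1 ->
    Re (f x) - a = x * Re (f1 x) * (1 - a * Re (f x)).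
Proof.
  intros Hf H0 Ha. destruct (schur_step f a Hf H0 Ha) as [f1 [Hf1 E]].
  exists f1; split; [exact Hf1|]. intros x Hx.
  specialize (E x ltac:(now rewrite Cmod_R)).
  rewrite (schur_real f x), (schur_real f1 x) in E by assumption.
  apply RtoC_inj. rewrite RtoC_minus, !RtoC_mult, RtoC_minus, RtoC_mult. exact E.
Qed.

Lemma schur_0_real f : schur f -> f 0 = RtoC (Re (f 0)).
Proof. intros Hf. apply (schur_real f 0 Hf). rewrite Rabs_R0; lra. Qed.

(** For [|a| < 1] this is the Schur step with [|f1| <= 1]; for [|a| = 1] the function is constant
    and the left side is 0. Covering the second case lets [g2] be 0 or 1 in the second half of the
    theorem. *)
Lemma schwarz_pick_real f a x : schur f -> f 0 = RtoC a -> Rabs x < 1 ->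
  (Re (f x) - a) ^ 2 <= x ^ 2 * (1 - a * Re (f x)) ^ 2.
Proof.
  intros Hf H0 Hx.
  assert (Ha : Rabs a <= 1).
  { replace a with (Re (f 0)) by (rewrite H0; reflexivity).
    apply (schur_Re_le f 0 Hf). rewrite Rabs_R0; lra. }
  destruct (Req_dec (Rabs a) 1) as [E|N].
  - rewrite (schur_const f a Hf H0 E) by now rewrite Cmod_R.
    simpl Re. replace ((a - a) ^ 2) with 0 by ring.
    apply Rmult_le_pos; apply pow2_ge_0.
  - destruct (schur_step_real f a Hf H0) as [f1 [Hf1 E]]; [lra|].
    rewrite (E x Hx). pose proof (schur_Re_le f1 x Hf1 Hx) as B.
    assert (B2 : Re (f1 x) ^ 2 <= 1).
    { apply Rabs_le_between in B. nra. }
    replace ((x * Re (f1 x) * (1 - a * Re (f x))) ^ 2)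
      with (x ^ 2 * (1 - a * Re (f x)) ^ 2 * Re (f1 x) ^ 2) by ring.
    rewrite <- (Rmult_1_r (x ^ 2 * _)) at 2. apply Rmult_le_compat_l; [|exact B2].
    apply Rmult_le_pos; apply pow2_ge_0.
Qed.

Lemma continuity_pt_eq_at_0 g h : continuity_pt g 0 -> continuity_pt h 0 ->
  (forall x, 0 < Rabs x < 1 -> g x = h x) -> g 0 = h 0.
Proof.
  intros Hg Hh E. destruct (Req_dec (g 0) (h 0)) as [|N]; [assumption|exfalso].
  assert (Hc : continuity_pt (g - h)%F 0) by now apply continuity_pt_minus.
  assert (P : 0 < Rabs (g 0 - h 0)) by (apply Rabs_pos_lt; lra).
  destruct (proj1 (continuity_pt_locally _ _) Hc (mkposreal _ P)) as [d Hd].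
  pose proof (cond_pos d). pose proof (Rmin_glb_lt d 1 0 (cond_pos d) Rlt_0_1).
  pose proof (Rmin_l d 1); pose proof (Rmin_r d 1). set (x := Rmin d 1 / 2) in *.
  assert (Hx : Rabs x = x) by (apply Rabs_pos_eq; unfold x; lra).
  specialize (Hd x). unfold minus_fct in Hd; simpl in Hd.
  rewrite E in Hd by (rewrite Hx; unfold x; lra).
  assert (B : ball 0 d x).
  { change (Rabs (x - 0) < d). rewrite Rminus_0_r, Hx. unfold x; lra. }
  specialize (Hd B). replace (h x - h x - (g 0 - h 0)) with (- (g 0 - h 0)) in Hd by ring.
  rewrite Rabs_Ropp in Hd. lra.
Qed.

Definition strip_coord (w : R) : R := 2 * ln ((1 + w) / (1 - w)).

(** The map is odd, so it has no second-order term. The estimate comes from the mean value theorem,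
    the derivative of [strip_coord t - 4 * t] being [4 * t ^ 2 / (1 - t ^ 2)]. *)
Lemma strip_coord_expansion : exists e, continuity_pt e 0 /\ e 0 = 0 /\
  forall w, strip_coord w = 4 * w + w * w * e w.
Proof.
  assert (X0 : strip_coord 0 = 0).
  { unfold strip_coord. replace ((1 + 0) / (1 - 0)) with 1 by field. rewrite ln_1; ring. }
  set (e := fun w => (strip_coord w - 4 * w) / (w * w)).
  (* The numerator vanishes at 0, so whatever the value of [/ 0], the quotient there is 0, which is
     also its limit. *)
  assert (E0 : e 0 = 0) by (unfold e; rewrite X0; unfold Rdiv; ring).
  exists e. split; [|split; [exact E0|]].
  - assert (B : forall w, Rabs w <= / 2 -> Rabs (e w) <= 8 * Rabs w).
    { intros w Hw. destruct (Req_dec w 0) as [->|N].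
      { rewrite E0, Rabs_R0; lra. }
      apply Rabs_le_between in Hw.
      destruct (MVT_gen (fun t => strip_coord t - 4 * t) 0 w (fun t => 4 * t ^ 2 / (1 - t ^ 2)))
        as [c [Hc Ec]].
      - intros t Ht.
        assert (Ht2 : - / 2 <= t <= / 2).
        { pose proof (Rmin_l 0 w); pose proof (Rmin_r 0 w); pose proof (Rmax_l 0 w);
          pose proof (Rmax_r 0 w). destruct (Rle_dec 0 w);
          [rewrite Rmin_left, Rmax_right in Ht by lra|rewrite Rmin_right, Rmax_left in Ht by lra]; lra. }
        unfold strip_coord. auto_derive.
        + split; [lra|]. split; [|easy]. apply Rdiv_lt_0_compat; lra.
        + field. nra.
      - intros t Ht.
        assert (Ht2 : - / 2 <= t <= / 2).
        { destruct (Rle_dec 0 w);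
          [rewrite Rmin_left, Rmax_right in Ht by lra|rewrite Rmin_right, Rmax_left in Ht by lra]; lra. }
        apply continuity_pt_filterlim.
        apply (ex_derive_continuous (V := R_NormedModule) (fun t => strip_coord t - 4 * t)).
        unfold strip_coord. auto_derive.
        repeat split; [lra|apply Rdiv_lt_0_compat; lra].
      - rewrite X0 in Ec. replace (0 - 4 * 0) with 0 in Ec by ring. rewrite !Rminus_0_r in Ec.
        unfold e. rewrite Ec.
        assert (Hc2 : c ^ 2 <= w ^ 2 /\ c ^ 2 <= / 4).
        { destruct (Rle_dec 0 w);
          [rewrite Rmin_left, Rmax_right in Hc by lra|rewrite Rmin_right, Rmax_left in Hc by lra];
          split; nra. }
        replace (4 * c ^ 2 / (1 - c ^ 2) * w / (w * w)) with (4 * c ^ 2 / ((1 - c ^ 2) * w))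
          by (field; split; [|exact N]; nra).
        unfold Rdiv. rewrite Rabs_mult, Rabs_inv, (Rabs_mult (1 - c ^ 2)).
        rewrite (Rabs_pos_eq (4 * c ^ 2)), (Rabs_pos_eq (1 - c ^ 2)) by nra.
        assert (Hw0 : 0 < Rabs w) by now apply Rabs_pos_lt.
        assert (Hw2 : w ^ 2 = Rabs w * Rabs w) by (rewrite <- Rabs_mult, Rabs_pos_eq; nra).
        apply (Rmult_le_reg_r ((1 - c ^ 2) * Rabs w)); [nra|].
        rewrite Rmult_assoc, Rinv_l by nra.
        assert (3 / 4 * (Rabs w * Rabs w) <= (1 - c ^ 2) * (Rabs w * Rabs w)) by
          (apply Rmult_le_compat_r; nra).
        nra. }
    apply continuity_pt_locally. intros eps. pose proof (cond_pos eps).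
    assert (P : 0 < Rmin (/ 2) (eps / 8)) by (apply Rmin_glb_lt; lra).
    exists (mkposreal _ P). intros w Hw. change (Rabs (w - 0) < Rmin (/ 2) (eps / 8)) in Hw.
    rewrite Rminus_0_r in Hw. apply Rmin_Rgt in Hw as [G1 G2].
    rewrite E0, Rminus_0_r. specialize (B w ltac:(lra)). lra.
  - intros w. unfold e. destruct (Req_dec w 0) as [->|N]; [rewrite X0; ring|field; exact N].
Qed.

Lemma cont_plus f g x : continuity_pt f x -> continuity_pt g x ->
  continuity_pt (fun t => f t + g t) x.
Proof. exact (continuity_pt_plus f g x). Qed.

Lemma cont_minus f g x : continuity_pt f x -> continuity_pt g x ->
  continuity_pt (fun t => f t - g t) x.
Proof. exact (continuity_pt_minus f g x). Qed.

Lemma cont_mult f g x : continuity_pt f x -> continuity_pt g x ->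
  continuity_pt (fun t => f t * g t) x.
Proof. exact (continuity_pt_mult f g x). Qed.

Lemma cont_const c x : continuity_pt (fun _ => c) x.
Proof. apply continuity_pt_const. intros u v; reflexivity. Qed.

Lemma cont_id x : continuity_pt (fun t => t) x.
Proof. exact (derivable_continuous_pt _ _ (derivable_pt_id x)). Qed.

Ltac cont := repeat first [assumption | apply cont_minus | apply cont_plus | apply cont_mult
  | apply cont_const | apply cont_id].

(** Coefficients are compared by dividing by [x], then by [x * x], away from 0 and passing to the
    limit by continuity. *)
Lemma cancel_first_order g h c d : continuity_pt g 0 -> continuity_pt h 0 ->
  (forall x, 0 < Rabs x < 1 -> c * x + x * x * g x = d * x + x * x * h x) ->
  c = d /\ g 0 = h 0.
Proof.
  intros Hg Hh E.
  assert (Ecd : c = d).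
  { pose proof (continuity_pt_eq_at_0 (fun x => c + x * g x) (fun x => d + x * h x)) as T.
    simpl in T. rewrite !Rmult_0_l, !Rplus_0_r in T. apply T; [cont|cont|].
    intros x Hx. assert (x <> 0) by (intros ->; rewrite Rabs_R0 in Hx; lra).
    specialize (E x Hx). apply (Rmult_eq_reg_l x); [lra|assumption]. }
  split; [exact Ecd|]. apply continuity_pt_eq_at_0; auto.
  intros x Hx. assert (x <> 0) by (intros ->; rewrite Rabs_R0 in Hx; lra).
  specialize (E x Hx). subst d. apply (Rmult_eq_reg_l (x * x)); [lra|nra].
Qed.

(** Substituting [4 w + o(w^2)] into the expansion of [theta] multiplies the first coefficient by 4
    and the second, [taylor theta 2 / 2], by 16; hence the 4 and the 8. *)
Lemma theta_disc theta : A_1_pi theta ->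
  let T0 := taylor theta 0 in
  exists f, schur f /\ f 0 = RtoC T0 /\ Rabs T0 < 1 /\
    (forall x : R, Rabs x < 1 -> f x = theta (strip_coord x)) /\
    exists p, continuity_pt p 0 /\ p 0 = 8 * taylor theta 2 /\
      forall x : R, Rabs x < 1 -> Re (f x) = T0 + (4 * taylor theta 1 * x + x * x * p x).
Proof.
  intros HA T0. destruct (disc_transfer theta HA) as [f [Hf [Hf0 Hx]]].
  fold strip_coord in Hx.
  destruct (A_1_pi_taylor theta HA) as [P [HP [P0 EP]]].
  destruct strip_coord_expansion as [e [He [e0 Ee]]].
  assert (Hz : Rabs 0 < 1) by (rewrite Rabs_R0; lra).
  assert (X0 : strip_coord 0 = 0) by (rewrite Ee; ring).
  assert (F0 : f 0 = RtoC T0).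
  { rewrite (Hx 0 Hz). fold (strip_coord 0). rewrite X0, EP. f_equal. fold T0. ring. }
  exists f. split; [exact Hf|]. split; [exact F0|]. split.
  { rewrite F0, Cmod_R in Hf0. exact Hf0. }
  split; [exact Hx|].
  exists (fun x => taylor theta 1 * e x + (4 + x * e x) * (4 + x * e x) * P (strip_coord x)).
  split; [|split].
  - cont. apply (continuity_pt_comp strip_coord P).
    + apply (continuity_pt_ext (fun w => 4 * w + w * w * e w)); [intros; now rewrite Ee|cont].
    + now rewrite X0.
  - rewrite X0, e0, P0. field.
  - intros x H1. rewrite (Hx x H1). fold (strip_coord x). rewrite EP. simpl. fold T0.
    rewrite Ee at 1 2 3. ring.
Qed.

(** [F] and [G] are the first two Schur transforms. The sign of [taylor theta 1] gives [a > 0]; the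
    second step is conditional on [a < 1], since for [a = 1] the algorithm stops at [F]. *)
Lemma schur_coefficients theta : A_1_pi theta -> 0 < taylor theta 1 ->
  let T0 := taylor theta 0 in
  Rabs T0 < 1 /\
  exists F a, schur F /\ F 0 = RtoC a /\ 0 < a <= 1 /\ 4 * taylor theta 1 = a * (1 - T0 ^ 2) /\
    (forall x : R, Rabs x < 1 -> let y := Re (theta (strip_coord x)) in
       theta (strip_coord x) = RtoC y /\ Rabs y <= 1 /\ y - T0 = x * Re (F x) * (1 - T0 * y)) /\
    (a < 1 -> exists G b, schur G /\ G 0 = RtoC b /\
       8 * taylor theta 2 = (1 - T0 ^ 2) * (b * (1 - a ^ 2) - T0 * a ^ 2) /\
       forall x : R, Rabs x < 1 -> Re (F x) - a = x * Re (G x) * (1 - a * Re (F x))).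
Proof.
  intros HA HT T0. destruct (theta_disc theta HA) as [f [Hf [F0 [HT0 [Hx [p [Hp [p0 Ep]]]]]]]].
  fold T0 in F0, HT0, Ep. split; [exact HT0|].
  assert (Hz : Rabs 0 < 1) by (rewrite Rabs_R0; lra).
  destruct (schur_step_real f T0 Hf F0 HT0) as [F [HF EF]].
  set (a := Re (F 0)). exists F, a.
  assert (HFc : continuity_pt (fun t : R => Re (F t)) 0) by (now apply schur_Re_continuous).
  assert (Hfc : continuity_pt (fun t : R => Re (f t)) 0) by (now apply schur_Re_continuous).
  assert (Hf0 : Re (f 0) = T0) by (rewrite F0; reflexivity).
  assert (E1 : 4 * taylor theta 1 = a * (1 - T0 ^ 2)).
  { pose proof (continuity_pt_eq_at_0 (fun x : R => 4 * taylor theta 1 + x * p x)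
      (fun x : R => Re (F x) * (1 - T0 * Re (f x)))) as T. simpl in T.
    rewrite Hf0 in T. fold a in T.
    replace (4 * taylor theta 1) with (4 * taylor theta 1 + 0 * p 0) by ring.
    rewrite T; [ring|cont|cont|].
    intros x H1. assert (x <> 0) by (intros ->; rewrite Rabs_R0 in H1; lra).
    pose proof (EF x ltac:(lra)) as Q. pose proof (Ep x ltac:(lra)) as Q2.
    apply (Rmult_eq_reg_l x); [lra|assumption]. }
  assert (HT2 : 0 < 1 - T0 ^ 2) by (apply Rabs_def2 in HT0; nra).
  assert (Ha : 0 < a <= 1).
  { pose proof (schur_Re_le F 0 HF Hz) as B. fold a in B. apply Rabs_le_between in B.
    split; [|lra]. apply Rnot_le_lt; intros L. nra. }
  split; [exact HF|]. split; [now apply schur_0_real|]. split; [exact Ha|]. split; [exact E1|]. split.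
  - intros x H1 y. specialize (Hx x H1). unfold y. rewrite <- Hx.
    split; [now apply schur_real|]. split; [now apply schur_Re_le|now apply EF].
  - intros Ha1. destruct (schur_step_real F a HF (schur_0_real F HF)) as [G [HG EG]].
    { apply Rabs_def1; lra. }
    set (b := Re (G 0)). exists G, b. split; [exact HG|]. split; [now apply schur_0_real|].
    split; [|exact EG].
    assert (HGc : continuity_pt (fun t : R => Re (G t)) 0) by (now apply schur_Re_continuous).
    (* The second-order remainder of [f] after both Schur relations are substituted into
       [x F (1 - T0 f)] and the term [a (1 - T0^2) x] is split off; its value at 0 is the claimed
       formula. *)
    destruct (cancel_first_order p (fun x : R =>
      - (a * T0) * Re (F x) * (1 - T0 * Re (f x))
      + Re (G x) * (1 - a * Re (F x)) * (1 - T0 * Re (f x)))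
      (4 * taylor theta 1) (a * (1 - T0 ^ 2))) as [_ E2]; [cont|cont| |].
    { intros x H1.
      pose proof (EF x ltac:(lra)) as Q. pose proof (Ep x ltac:(lra)) as Q2.
      pose proof (EG x ltac:(lra)) as Q3.
      set (y := Re (f x)) in *. set (y1 := Re (F x)) in *. set (y2 := Re (G x)) in *.
      transitivity (y - T0); [lra|]. rewrite Q.
      transitivity (x * (a + (y1 - a)) * (1 - T0 * y)); [ring|]. rewrite Q3.
      replace (x * (a + x * y2 * (1 - a * y1)) * (1 - T0 * y))
        with (x * a * (1 - T0 ^ 2 - T0 * (y - T0)) + x * x * y2 * (1 - a * y1) * (1 - T0 * y)) by ring.
      rewrite Q at 1. ring. }
    rewrite p0, Hf0 in E2. fold a b in E2. rewrite E2. ring.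
Qed.

(** * Location of the zeros *)

(** This is [tanh (t / 4)], written through [u = exp (t / 2)] because the quadratics are stated in
    [u]; it inverts [strip_coord]. *)
Definition disc_coord (t : R) : R := (exp (t / 2) - 1) / (exp (t / 2) + 1).

Lemma disc_coord_lt t : Rabs (disc_coord t) < 1.
Proof.
  pose proof (exp_pos (t / 2)) as H. unfold disc_coord. set (u := exp (t / 2)) in *.
  apply Rabs_def1; apply (Rmult_lt_reg_r (u + 1)); try lra;
    unfold Rdiv; rewrite Rmult_assoc, Rinv_l by lra; lra.
Qed.

Lemma strip_coord_disc t : strip_coord (disc_coord t) = t.
Proof.
  pose proof (exp_pos (t / 2)) as H. unfold strip_coord, disc_coord.
  replace ((1 + (exp (t / 2) - 1) / (exp (t / 2) + 1)) / (1 - (exp (t / 2) - 1) / (exp (t / 2) + 1)))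
    with (exp (t / 2)) by (field; lra).
  rewrite ln_exp. field.
Qed.

Lemma disc_coord_neq0 t : t <> 0 -> disc_coord t <> 0.
Proof.
  intros Ht E. apply Ht. rewrite <- (strip_coord_disc t), E. unfold strip_coord.
  replace ((1 + 0) / (1 - 0)) with 1 by field. rewrite ln_1; ring.
Qed.

Lemma disc_coord_0 : disc_coord 0 = 0.
Proof. unfold disc_coord. replace (0 / 2) with 0 by field. rewrite exp_0. field. Qed.

Lemma disc_coord_continuous t : continuity_pt disc_coord t.
Proof.
  apply continuity_pt_filterlim. apply (ex_derive_continuous (V := R_NormedModule) disc_coord).
  unfold disc_coord. auto_derive. pose proof (exp_pos (t * / 2)). repeat split; lra.
Qed.

Lemma quadratic_nonneg_outside A B D u : 0 < A -> D <= (2 * A * u - B) ^ 2 ->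
  u <= (B - sqrt D) / (2 * A) \/ (B + sqrt D) / (2 * A) <= u.
Proof.
  intros HA H.
  assert (E : forall x, x / (2 * A) * (2 * A) = x) by (intros; field; lra).
  destruct (Rle_lt_dec u ((B - sqrt D) / (2 * A))) as [|L1]; [now left|].
  destruct (Rle_lt_dec ((B + sqrt D) / (2 * A)) u) as [|L2]; [now right|exfalso].
  apply (Rmult_lt_compat_r (2 * A)) in L1; [|lra]. apply (Rmult_lt_compat_r (2 * A)) in L2; [|lra].
  rewrite E in L1, L2. pose proof (sqrt_pos D).
  destruct (Rle_lt_dec 0 D) as [P|P].
  - pose proof (sqrt_sqrt D P). nra.
  (* For negative [D] the square root is 0 by convention, the two bounds coincide, and every [u]
     lies on one side. *)
  - rewrite sqrt_neg_0 in * by lra. nra.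
Qed.

Lemma quadratic_root A B C s D : 0 < A -> D = B ^ 2 - 4 * A * C -> 0 <= D ->
  s = sqrt D \/ s = - sqrt D -> let u := (B + s) / (2 * A) in A * u ^ 2 - B * u + C = 0.
Proof.
  intros HA HD H0 Hs u.
  assert (Es : s ^ 2 = D) by (pose proof (sqrt_sqrt D H0); destruct Hs; subst s; lra).
  unfold u.
  replace (A * ((B + s) / (2 * A)) ^ 2 - B * ((B + s) / (2 * A)) + C)
    with ((s ^ 2 - (B ^ 2 - 4 * A * C)) / (4 * A)) by (field; lra).
  rewrite Es, HD. field; lra.
Qed.

(** Multiplied by [w^2], with [w y] replaced by [- a], the Schwarz-Pick inequality becomes
    [(a + b w)^2 <= (w^2 + a b w)^2], a difference of squares equal to [P * Q >= 0]. As
    [P + Q = 2 w^2 (1 - b y) >= 0], the factor [P] cannot be negative. *)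
Lemma schwarz_pick_zero_bound a b w y : 0 < a -> Rabs b <= 1 -> Rabs y <= 1 -> w * y = - a ->
  (y - b) ^ 2 <= w ^ 2 * (1 - b * y) ^ 2 -> 0 <= w ^ 2 - b * (1 - a) * w - a.
Proof.
  intros Ha Hb Hy E H. apply Rabs_le_between in Hb; apply Rabs_le_between in Hy.
  set (P := w ^ 2 - b * (1 - a) * w - a). set (Q := w ^ 2 + b * (1 + a) * w + a).
  assert (PQ : 0 <= P * Q).
  { assert (H2 : w ^ 2 * (y - b) ^ 2 <= w ^ 2 * (w ^ 2 * (1 - b * y) ^ 2))
      by (apply Rmult_le_compat_l; [apply pow2_ge_0|exact H]).
    replace (w ^ 2 * (y - b) ^ 2) with ((w * y - b * w) ^ 2) in H2 by ring.
    replace (w ^ 2 * (w ^ 2 * (1 - b * y) ^ 2)) with ((w * (w - b * (w * y))) ^ 2) in H2 by ring.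
    rewrite E in H2. unfold P, Q. nra. }
  assert (S : 0 <= P + Q).
  { replace (P + Q) with (2 * (w ^ 2 + a * b * w)) by (unfold P, Q; ring).
    replace a with (- (w * y)) by lra.
    replace (w ^ 2 + - (w * y) * b * w) with (w ^ 2 * (1 - y * b)) by ring.
    apply Rmult_le_pos; [lra|]. apply Rmult_le_pos; [apply pow2_ge_0|nra]. }
  apply Rnot_lt_le; intros L. nra.
Qed.

(** The three Schur relations, with [F_3 = 1] in the innermost, are solved from the inside out:
    [w y2 = n2 / d2], then [w y1 = (m - 1) / (m + 1)] where [m = u g(u^2 - 1)] for the terminating
    fraction [g], and finally [y]. *)
Lemma terminating_value g1 g2 u T0 y y1 y2 :
  0 < g1 < 1 -> 0 < g2 < 1 -> 0 < u -> -1 < T0 < 1 ->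
  let a := 1 - 2 * g1 in let b := 2 * g2 - 1 in let w := (u - 1) / (u + 1) in
  y2 - b = w * (1 - b * y2) -> y1 - a = w * y2 * (1 - a * y1) ->
  y - T0 = w * y1 * (1 - T0 * y) ->
  y = 1 - 2 / ((1 + T0) / (1 - T0) * u * terminating_g_fraction g1 g2 (u * u - 1) + 1).
Proof.
  intros Hg1 Hg2 Hu HT a b w E2 E1 E0.
  set (v := u * u - 1). set (N := 1 + (1 - g1) * g2 * v). set (D := N + g1 * v).
  assert (Huu : 0 < u * u) by nra.
  assert (HN : 0 < N).
  { unfold N, v. assert (0 < (1 - g1) * g2) by nra.
    assert ((1 - g1) * g2 < 1) by nra. nra. }
  assert (HD : 0 < D).
  { unfold D, N, v.
    replace (1 + (1 - g1) * g2 * (u * u - 1) + g1 * (u * u - 1))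
      with (g1 * (u * u) + (1 - g1) * ((1 - g2) + g2 * (u * u))) by ring.
    apply Rplus_lt_0_compat; [nra|]. apply Rmult_lt_0_compat; [lra|]. nra. }
  set (m := u * N / D).
  assert (Hm : 0 < m) by (unfold m; apply Rdiv_lt_0_compat; nra).
  assert (Em : u * terminating_g_fraction g1 g2 v = m).
  { unfold terminating_g_fraction, m. fold N.
    replace (1 + g1 * v / N) with (D / N) by (unfold D; field; lra). field; lra. }
  set (d2 := (u + 1) * (g2 * u + (1 - g2))). set (n2 := (u - 1) * (g2 * u - (1 - g2))).
  assert (Hd2 : 0 < d2) by (unfold d2; apply Rmult_lt_0_compat; nra).
  assert (Ew : w * (u + 1) = u - 1) by (unfold w; field; lra).
  assert (R2 : w * y2 * d2 = n2).
  { assert (Q : y2 * (g2 * u + (1 - g2)) = g2 * u - (1 - g2)).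
    { assert (Q1 : (y2 - b) * (u + 1) = (u - 1) * (1 - b * y2)) by (rewrite E2, <- Ew; ring).
      unfold b in Q1. lra. }
    unfold d2, n2. rewrite <- Q, <- Ew. ring. }
  assert (R1 : y1 * (d2 + a * n2) = a * d2 + n2).
  { assert (Q1 : (y1 - a) * d2 = w * y2 * d2 * (1 - a * y1)) by (rewrite E1; ring).
    rewrite R2 in Q1. lra. }
  assert (Rw : w * y1 * (m + 1) = m - 1).
  { apply (Rmult_eq_reg_r (2 * D * (u + 1))); [|nra].
    replace (w * y1 * (m + 1) * (2 * D * (u + 1)))
      with (w * (u + 1) * y1 * (2 * (u * N + D))) by (unfold m; field; lra).
    replace ((m - 1) * (2 * D * (u + 1))) with (2 * (u * N - D) * (u + 1)) by (unfold m; field; lra).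
    replace (2 * (u * N + D)) with ((u + 1) * (d2 + a * n2))
      by (unfold D, N, v, d2, n2, a; ring).
    replace (2 * (u * N - D)) with ((u - 1) * (a * d2 + n2))
      by (unfold D, N, v, d2, n2, a; ring).
    rewrite Ew, <- R1. ring. }
  rewrite (Rmult_assoc _ u), Em.
  assert (Hmu : 0 < (1 + T0) * m + (1 - T0)) by (assert (0 < (1 + T0) * m) by nra; lra).
  assert (Ey : y * ((1 + T0) * m + (1 - T0)) = (1 + T0) * m - (1 - T0)).
  { assert (Q : (y - T0) * (m + 1) = w * y1 * (m + 1) * (1 - T0 * y)) by (rewrite E0; ring).
    rewrite Rw in Q. lra. }
  replace (2 / ((1 + T0) / (1 - T0) * m + 1)) with (2 * (1 - T0) / ((1 + T0) * m + (1 - T0)))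
    by (field; split; lra).
  apply (Rmult_eq_reg_r ((1 + T0) * m + (1 - T0))); [|lra]. rewrite Ey. field. lra.
Qed.

(** * The coefficients [g1], [g2] as Schur parameters, and the two halves of the theorem *)

Lemma taylor_0_eq theta : A_1_pi theta -> theta 0 = RtoC (taylor theta 0).
Proof.
  intros [_ [Hr _]]. specialize (Hr 0). change (taylor theta 0) with (Re (theta 0)).
  destruct (theta 0) as [x y]; simpl in *. unfold RtoC; now rewrite Hr.
Qed.

Lemma coef_g1_schur theta a : Rabs (taylor theta 0) < 1 ->
  4 * taylor theta 1 = a * (1 - taylor theta 0 ^ 2) -> coef_g1 theta = (1 - a) / 2.
Proof.
  intros H0 H1. apply Rabs_def2 in H0. unfold coef_g1. rewrite H1. field. nra.
Qed.

Lemma coef_g2_schur theta a b : Rabs (taylor theta 0) < 1 -> 0 < a < 1 ->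
  4 * taylor theta 1 = a * (1 - taylor theta 0 ^ 2) ->
  8 * taylor theta 2
    = (1 - taylor theta 0 ^ 2) * (b * (1 - a ^ 2) - taylor theta 0 * a ^ 2) ->
  coef_g2 theta = (1 + b) / 2.
Proof.
  intros H0 Ha H1 H2. apply Rabs_def2 in H0. unfold coef_g2.
  set (t0 := taylor theta 0) in *.
  replace (16 * taylor theta 1 ^ 2) with ((4 * taylor theta 1) ^ 2) by ring.
  rewrite H1, H2.
  assert (0 < 1 - t0 ^ 2) by nra.
  replace ((1 - t0 ^ 2 + a * (1 - t0 ^ 2)) * (a * (1 - t0 ^ 2) - 1 + t0 ^ 2))
    with (- ((1 - t0 ^ 2) ^ 2 * (1 - a ^ 2))) by ring.
  field. split; nra.
Qed.


(** Stated for an arbitrary positive root [u0] other than 1, so that it serves both regions; the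
    sign of [zeta] is left open. *)
Lemma exists_return_before_root theta u0 : A_1_pi theta -> 0 < taylor theta 1 ->
  let g1 := coef_g1 theta in let g2 := coef_g2 theta in
  0 < g1 < / 2 -> 0 < g2 < 1 -> 0 < u0 -> u0 <> 1 ->
  (1 - g1) * g2 * u0 ^ 2 - g1 * u0 + (1 - g1) * (1 - g2) = 0 ->
  let zeta := 2 * ln u0 in
  exists tau : R, tau <> 0 /\ theta (RtoC tau) = theta (RtoC 0) /\
    ((0 < tau < zeta \/ zeta < tau < 0) \/ (tau = zeta /\ terminating theta)).
Proof.
  intros HA HT g1 g2 Hg1 Hg2 Hu0 Hu1 EQ zeta.
  destruct (schur_coefficients theta HA HT) as [HT0 [F [a [HF [F0 [Ha [E1 [HFx HG]]]]]]]].
  pose proof (coef_g1_schur theta a HT0 E1) as G1; fold g1 in G1.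
  destruct (HG ltac:(lra)) as [G [b [HGs [G0 [E2 HGx]]]]].
  pose proof (coef_g2_schur theta a b HT0 ltac:(lra) E1 E2) as G2; fold g2 in G2.
  clear HG. set (T0 := taylor theta 0) in *.
  assert (Hb : Rabs b < 1) by (apply Rabs_def1; lra).
  destruct (schur_step_real G b HGs G0 Hb) as [H [HH EH]].
  assert (Hz : exp (zeta / 2) = u0).
  { unfold zeta. replace (2 * ln u0 / 2) with (ln u0) by field. now apply exp_ln. }
  assert (Hz0 : zeta <> 0).
  { intros E. apply Hu1. rewrite <- Hz, E. replace (0 / 2) with 0 by field. apply exp_0. }
  assert (Hzero : forall t, t <> 0 -> Re (F (disc_coord t)) = 0 -> theta (RtoC t) = theta (RtoC 0)).
  { intros t Ht E. destruct (HFx (disc_coord t) (disc_coord_lt t)) as [Q1 [_ Q2]].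
    rewrite strip_coord_disc in *. rewrite Q1, (taylor_0_eq theta HA). fold T0. f_equal.
    rewrite E in Q2. lra. }
  set (w0 := disc_coord zeta).
  assert (Hw0 : Rabs w0 < 1) by apply disc_coord_lt.
  assert (Hw00 : w0 <> 0) by now apply disc_coord_neq0.
  assert (Ew0 : w0 = (u0 - 1) / (u0 + 1)) by (unfold w0, disc_coord; now rewrite Hz).
  (* The quadratic for [u0], transported to the disc coordinate: the two forms differ by the factor
     [4 / (u0 + 1) ^ 2]. *)
  assert (EQw : w0 ^ 2 + b * (1 + a) * w0 + a = 0).
  { rewrite Ew0.
    replace (((u0 - 1) / (u0 + 1)) ^ 2 + b * (1 + a) * ((u0 - 1) / (u0 + 1)) + a)
      with (4 * ((1 - g1) * g2 * u0 ^ 2 - g1 * u0 + (1 - g1) * (1 - g2)) / (u0 + 1) ^ 2)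
      by (rewrite G1, G2; field; lra).
    rewrite EQ. field; lra. }
  set (h := Re (H w0)). set (y2 := Re (G w0)). set (y1 := Re (F w0)).
  pose proof (EH w0 Hw0) as Q3; fold h y2 in Q3.
  pose proof (HGx w0 Hw0) as Q2; fold y1 y2 in Q2.
  pose proof (schur_Re_le H w0 HH Hw0) as Bh; fold h in Bh.
  pose proof (schur_Re_le G w0 HGs Hw0) as By2; fold y2 in By2.
  apply Rabs_le_between in Bh; apply Rabs_le_between in By2.
  apply Rabs_def2 in Hb. pose proof Hw0 as Hw1. apply Rabs_def2 in Hw1.
  assert (Hw2 : 0 < w0 ^ 2 < 1) by (split; [apply pow2_gt_0; exact Hw00|nra]).
  assert (Pb : 0 < 1 + b * w0) by nra.
  assert (Pbh : 0 < 1 + b * w0 * h).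
  { assert (- 1 < b * w0 < 1) by nra. nra. }
  (* Modulo [EQw], the product with the positive number [1 + b * w0] is [w0 ^ 2 * (1 - b ^ 2)]. *)
  assert (Pw : 0 < w0 ^ 2 + a * b * w0).
  { apply (Rmult_lt_reg_r (1 + b * w0)); [exact Pb|]. rewrite Rmult_0_l.
    replace ((w0 ^ 2 + a * b * w0) * (1 + b * w0))
      with (w0 ^ 2 * (1 - b ^ 2) + b * w0 * (w0 ^ 2 + b * (1 + a) * w0 + a)) by ring.
    rewrite EQw, Rmult_0_r, Rplus_0_r. apply Rmult_lt_0_compat; nra. }
  assert (Py : 0 < 1 + a * (w0 * y2)).
  { assert (- 1 < w0 * y2 < 1) by nra. nra. }
  (* Elimination of [y2] from the last two Schur relations, followed by [EQw]. All factors but [y1]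
     and [h - 1] are positive, so these two have the same sign. *)
  assert (Kh : y1 * ((1 + a * (w0 * y2)) * (1 + b * w0 * h)) = (h - 1) * (w0 ^ 2 + a * b * w0)).
  { replace (y1 * ((1 + a * (w0 * y2)) * (1 + b * w0 * h)))
      with ((a + w0 * y2) * (1 + b * w0 * h)).
    2:{ replace (a + w0 * y2) with (y1 * (1 + a * (w0 * y2))) by lra. ring. }
    assert (Ey2 : y2 * (1 + b * w0 * h) = b + w0 * h) by lra.
    replace ((a + w0 * y2) * (1 + b * w0 * h))
      with (a * (1 + b * w0 * h) + w0 * (y2 * (1 + b * w0 * h))) by ring.
    rewrite Ey2.
    replace (a * (1 + b * w0 * h) + w0 * (b + w0 * h))
      with ((h - 1) * (w0 ^ 2 + a * b * w0) + (w0 ^ 2 + b * (1 + a) * w0 + a)) by ring.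
    rewrite EQw. ring. }
  assert (PP : 0 < (1 + a * (w0 * y2)) * (1 + b * w0 * h)) by now apply Rmult_lt_0_compat.
  destruct (Req_dec h 1) as [Eh|Nh].
  - assert (y10 : y1 = 0).
    { rewrite Eh in Kh. replace ((1 - 1) * (w0 ^ 2 + a * b * w0)) with 0 in Kh by ring.
      apply Rmult_integral in Kh. destruct Kh; [assumption|]. rewrite Eh in PP. lra. }
    exists zeta. split; [exact Hz0|]. split; [now apply Hzero|]. right. split; [reflexivity|].
    set (c := Re (H 0)).
    pose proof (schur_0_real H HH) as H0; fold c in H0.
    pose proof (schwarz_pick_real H c w0 HH H0 Hw0) as SP. fold h in SP. rewrite Eh, Rmult_1_r in SP.
    (* Schwarz-Pick at [w0] gives [(1 - c)^2 <= w0^2 (1 - c)^2] with [w0^2 < 1]. The third transform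
       then equals 1 at the centre and is constant. *)
    assert (Ec : c = 1).
    { destruct (Req_dec c 1) as [|N]; [assumption|exfalso].
      assert (0 < (1 - c) ^ 2) by (apply pow2_gt_0; lra). nra. }
    rewrite Ec in H0.
    intros x. set (w := disc_coord x). set (u := exp (x / 2)).
    destruct (HFx w (disc_coord_lt x)) as [R1 [_ R2]].
    unfold w in R1, R2. rewrite strip_coord_disc in R1, R2. fold w in R1, R2.
    pose proof (HGx w (disc_coord_lt x)) as R3. pose proof (EH w (disc_coord_lt x)) as R4.
    rewrite (schur_const H 1 HH H0 ltac:(apply Rabs_R1) w) in R4
      by (rewrite Cmod_R; apply disc_coord_lt).
    simpl Re in R4. rewrite Rmult_1_r in R4.
    rewrite R1. f_equal. fold T0 g1 g2.
    replace (exp x) with (u * u) by (unfold u; rewrite <- exp_plus; f_equal; field).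
    apply (terminating_value g1 g2 u T0 (Re (theta x)) (Re (F w)) (Re (G w)));
      try lra; try (apply exp_pos).
    + apply Rabs_def2 in HT0. lra.
    + replace (2 * g2 - 1) with b by lra. exact R4.
    + replace (1 - 2 * g1) with a by lra. exact R3.
    + exact R2.
  - assert (Hy1 : y1 < 0).
    { apply Rnot_le_lt; intros L. assert (0 < (1 - h) * (w0 ^ 2 + a * b * w0)) by
        (apply Rmult_lt_0_compat; lra). nra. }
    (* [phi] runs from [a > 0] at 0 to [y1 < 0] at [zeta], so it vanishes strictly in between. *)
    set (phi := fun t => Re (F (disc_coord t))).
    assert (P0 : phi 0 = a) by (unfold phi; rewrite disc_coord_0, F0; reflexivity).
    destruct (IVT_gen phi 0 zeta 0) as [tau [Htau Et]].
    { intros t. apply (continuity_pt_comp disc_coord (fun x : R => Re (F x))).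
      - apply disc_coord_continuous.
      - apply schur_Re_continuous; [exact HF|apply disc_coord_lt]. }
    { rewrite P0. change (phi zeta) with y1. rewrite Rmin_right, Rmax_left by lra. lra. }
    assert (tau <> 0) by (intros ->; lra).
    assert (tau <> zeta) by (intros ->; change (phi zeta) with y1 in Et; lra).
    exists tau. split; [assumption|]. split; [now apply Hzero|]. left.
    destruct (Rle_dec 0 zeta); [rewrite Rmin_left, Rmax_right in Htau by lra|
      rewrite Rmin_right, Rmax_left in Htau by lra]; [left|right]; lra.
Qed.

(** A return forces [F(w) = 0], hence [w G(w) = - a]; [schwarz_pick_zero_bound] then places
    [u = exp (tau / 2)] where the quadratic with discriminant [D1] is nonnegative. *)
Lemma return_outside_gap theta tau : A_1_pi theta -> 0 < taylor theta 1 ->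
  tau <> 0 -> theta (RtoC tau) = theta (RtoC 0) ->
  outside_gap (coef_g1 theta) (coef_g2 theta) tau.
Proof.
  intros HA HT Htau E.
  destruct (schur_coefficients theta HA HT) as [HT0 [F [a [HF [F0 [Ha [E1 [HFx HG]]]]]]]].
  set (w := disc_coord tau). pose proof (disc_coord_lt tau : Rabs w < 1) as Hw.
  pose proof (disc_coord_neq0 tau Htau : w <> 0) as Hw0.
  assert (EF : Re (F w) = 0).
  { destruct (HFx w Hw) as [_ [_ Q]]. rewrite (strip_coord_disc tau : strip_coord w = tau) in Q.
    rewrite E, (taylor_0_eq theta HA) in Q. simpl Re in Q. set (T0 := taylor theta 0) in *.
    assert (0 < 1 - T0 * T0) by (apply Rabs_def2 in HT0; nra).
    assert (Q2 : w * Re (F w) * (1 - T0 * T0) = 0) by lra.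
    apply Rmult_integral in Q2 as [Q2|Q2]; [|lra]. apply Rmult_integral in Q2 as [Q2|Q2]; [lra|exact Q2]. }
  (* If [a = 1], then [F] would be the constant 1 and could not vanish at [w]. *)
  assert (Ha1 : a < 1).
  { apply Rnot_le_lt; intros L. assert (a = 1) as Ea by lra.
    rewrite (schur_const F a HF F0) in EF; [simpl in EF; lra|rewrite Ea; apply Rabs_R1|].
    now rewrite Cmod_R. }
  destruct (HG Ha1) as [G [b [HGs [G0 [E2 HGx]]]]].
  rewrite (coef_g1_schur theta a HT0 E1), (coef_g2_schur theta a b HT0 ltac:(lra) E1 E2).
  set (g1 := (1 - a) / 2). set (g2 := (1 + b) / 2).
  assert (Hb : Rabs b <= 1).
  { replace b with (Re (G 0)) by (rewrite G0; reflexivity).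
    apply (schur_Re_le G 0 HGs). rewrite Rabs_R0; lra. }
  assert (P : 0 <= w ^ 2 - b * (1 - a) * w - a).
  { apply (schwarz_pick_zero_bound a b w (Re (G w))); [lra|exact Hb|now apply schur_Re_le| |].
    - specialize (HGx w Hw). rewrite EF in HGx. lra.
    - now apply schwarz_pick_real. }
  pose proof (exp_pos (tau / 2)) as Hu. set (u := exp (tau / 2)) in *.
  assert (Etau : tau = 2 * ln u) by (unfold u; rewrite ln_exp; field).
  assert (Pu : 0 <= g1 * (1 - g2) * u ^ 2 - (1 - g1) * u + g1 * g2).
  { replace (g1 * (1 - g2) * u ^ 2 - (1 - g1) * u + g1 * g2)
      with ((w ^ 2 - b * (1 - a) * w - a) * ((u + 1) ^ 2 / 4)).
    - apply Rmult_le_pos; [exact P|]. assert (0 < (u + 1) ^ 2) by nra. lra.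
    - unfold w, disc_coord; fold u. unfold g1, g2. field. lra. }
  apply Rabs_le_between in Hb.
  assert (Hg1 : 0 < g1 < / 2) by (unfold g1; lra).
  (* Positivity of [s] follows from [u > 0]; a nonpositive [t1_1] thus leaves only the upper
     alternative. *)
  assert (Hle : forall s, u <= s -> le_2log tau s).
  { intros s Hs. split; [lra|]. rewrite Etau.
    apply Rmult_le_compat_l; [lra|]. destruct Hs as [Hs| ->]; [now apply Rlt_le, ln_increasing|lra]. }
  split.
  - intros Hg2. assert (HA2 : 0 < g1 * (1 - g2)).
    { apply Rmult_lt_0_compat; [lra|]. unfold g2 in *; lra. }
    destruct (quadratic_nonneg_outside (g1 * (1 - g2)) (1 - g1) (D1 g1 g2) u HA2) as [L|L].
    + unfold D1. nra.
    + left. apply Hle. unfold t1_1. now rewrite (Rmult_assoc 2 g1).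
    + right. unfold t1_2. rewrite (Rmult_assoc 2 g1), Etau.
      apply Rmult_le_compat_l; [lra|].
      assert (0 < (1 - g1 + sqrt (D1 g1 g2)) / (2 * (g1 * (1 - g2)))).
      { pose proof (sqrt_pos (D1 g1 g2)). apply Rdiv_lt_0_compat; lra. }
      destruct L as [L|L]; [now apply Rlt_le, ln_increasing|rewrite L; lra].
  (* At [g2 = 1] the leading coefficient vanishes and the quadratic condition is the linear one
     [(1 - g1) * u <= g1]. *)
  - intros Hg2. apply Hle. rewrite Hg2 in Pu.
    apply (Rmult_le_reg_r (1 - g1)); [lra|].
    unfold Rdiv; rewrite Rmult_assoc, Rinv_l by lra. lra.
Qed.

(** The inequalities say that [t2_1 > 1] for [g2 < / 2] and [t2_2 < 1] for [g2 > / 2]. The quadratic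
    takes the positive value [1 - 2 * g1] at 1, so both roots lie on the same side of 1, and the
    position of the vertex decides which. *)
Lemma sqrt_D2_bounds g1 g2 : 0 < g1 < / 2 -> 0 < g2 < 1 -> 0 <= D2 g1 g2 ->
  (g2 < / 2 -> sqrt (D2 g1 g2) < g1 - 2 * (1 - g1) * g2) /\
  (/ 2 < g2 -> sqrt (D2 g1 g2) < 2 * (1 - g1) * g2 - g1).
Proof.
  intros H1 H2 HD. pose proof (sqrt_sqrt _ HD) as S. pose proof (sqrt_pos (D2 g1 g2)) as S0.
  set (s := sqrt (D2 g1 g2)) in *. unfold D2 in *.
  assert (K : s * s < (g1 - 2 * (1 - g1) * g2) ^ 2).
  { rewrite S. assert (0 < 4 * (1 - g1) * g2 * (1 - 2 * g1)) by (repeat apply Rmult_lt_0_compat; lra). nra. }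
  split; intros H.
  - assert (0 < g1 - 2 * (1 - g1) * g2).
    { apply Rnot_le_lt; intros L.
      assert (0 < (1 - g1) ^ 2 * (g2 * (1 - 2 * g2))) by (repeat apply Rmult_lt_0_compat; nra). nra. }
    nra.
  - assert (0 < 2 * (1 - g1) * g2 - g1) by nra. nra.
Qed.

Theorem theorem2p3 :
  forall theta : C -> C,
  A_1_pi theta ->
  0 < taylor theta 1 ->
  let g1 := coef_g1 theta in
  let g2 := coef_g2 theta in
  (region_E g1 g2 ->
     let zeta := 2 * ln (t2_1 g1 g2) in
     0 < zeta /\
     exists tau : R, tau <> 0 /\ theta (RtoC tau) = theta (RtoC 0) /\
       (0 < tau < zeta \/ (tau = zeta /\ terminating theta))) /\
  (region_F g1 g2 ->
     let zeta := 2 * ln (t2_2 g1 g2) in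
     zeta < 0 /\
     exists tau : R, tau <> 0 /\ theta (RtoC tau) = theta (RtoC 0) /\
       (zeta < tau < 0 \/ (tau = zeta /\ terminating theta))) /\
  (forall tau : R, tau <> 0 -> theta (RtoC tau) = theta (RtoC 0) ->
     outside_gap g1 g2 tau).
Proof.
  intros theta HA HT g1 g2. split; [|split].
  - intros [HD [H1 H2]] zeta.
    destruct (sqrt_D2_bounds g1 g2 H1 ltac:(lra) HD) as [K _]. specialize (K ltac:(lra)).
    assert (HA2 : 0 < (1 - g1) * g2) by (apply Rmult_lt_0_compat; lra).
    assert (Eu : t2_1 g1 g2 = (g1 + - sqrt (D2 g1 g2)) / (2 * ((1 - g1) * g2)))
      by (unfold t2_1; rewrite (Rmult_assoc 2); reflexivity).
    assert (Hu : 1 < t2_1 g1 g2).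
    { rewrite Eu. apply (Rmult_lt_reg_r (2 * ((1 - g1) * g2))); [lra|].
      unfold Rdiv. rewrite Rmult_assoc, Rinv_l by lra. lra. }
    assert (Hz : 0 < zeta) by (unfold zeta; pose proof (ln_increasing 1 _ Rlt_0_1 Hu); rewrite ln_1 in *; lra).
    split; [exact Hz|].
    destruct (exists_return_before_root theta (t2_1 g1 g2) HA HT) as [tau [Q1 [Q2 Q3]]];
      fold g1 g2; [exact H1|lra|lra|lra| |].
    + rewrite Eu. apply (quadratic_root _ _ _ _ (D2 g1 g2)); auto. unfold D2; ring.
    + exists tau. split; [exact Q1|]. split; [exact Q2|]. fold zeta g1 g2 in Q3.
      destruct Q3 as [[Q|Q]|Q]; [now left|lra|now right].
  - intros [HD [H1 H2]] zeta.
    destruct (sqrt_D2_bounds g1 g2 H1 ltac:(lra) HD) as [_ K]. specialize (K ltac:(lra)).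
    assert (HA2 : 0 < (1 - g1) * g2) by (apply Rmult_lt_0_compat; lra).
    assert (Eu : t2_2 g1 g2 = (g1 + sqrt (D2 g1 g2)) / (2 * ((1 - g1) * g2)))
      by (unfold t2_2; rewrite (Rmult_assoc 2); reflexivity).
    assert (Hu0 : 0 < t2_2 g1 g2).
    { rewrite Eu. pose proof (sqrt_pos (D2 g1 g2)). apply Rdiv_lt_0_compat; lra. }
    assert (Hu : t2_2 g1 g2 < 1).
    { rewrite Eu. apply (Rmult_lt_reg_r (2 * ((1 - g1) * g2))); [lra|].
      unfold Rdiv. rewrite Rmult_assoc, Rinv_l by lra. lra. }
    assert (Hz : zeta < 0) by (unfold zeta; pose proof (ln_increasing _ 1 Hu0 Hu); rewrite ln_1 in *; lra).
    split; [exact Hz|].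
    destruct (exists_return_before_root theta (t2_2 g1 g2) HA HT) as [tau [Q1 [Q2 Q3]]];
      fold g1 g2; [exact H1|lra|lra|lra| |].
    + rewrite Eu. apply (quadratic_root _ _ _ _ (D2 g1 g2)); auto. unfold D2; ring.
    + exists tau. split; [exact Q1|]. split; [exact Q2|]. fold zeta g1 g2 in Q3.
      destruct Q3 as [[Q|Q]|Q]; [lra|now left|now right].
  - intros tau H1 H2. now apply return_outside_gap.
Qed.
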